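(* For every integer $k\ge 1$ there is a constant $C=C(k)$ such that for all integers $n\ge 1$ and $m$ with $t_k(n)+1\le m\le t_{k+1}(n)$, setting $a=m-t_k(n)$, we have $$\left| f(n,m) - \left( \left(k-\frac1k\right)n+\sqrt{\frac{2(k+1)a}{k}}-\binom{k+1}{2}\right)\right| \le C\sqrt n .$$
   Context: All graphs are finite and simple. A graph is chordal if it contains no induced cycle of length at least $4$. Subgraphs are not required to be induced. For integers $n\ge 1$ and $0\le m\le \binom n2$, $f(n,m)$ denotes the maximum integer such that every graph with $n$ vertices and $m$ edges contains a chordal subgraph with at least $f(n,m)$ edges. $T_k(n)$ is the Turán graph, i.e. the complete $k$-partite graph on $n$ vertices with part sizes as equal as possible (some parts may be empty if $k>n$), and $t_k(n)$ is its number of edges. *)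

(* Defs.v *)
From mathcomp Require Import all_boot.

Set Implicit Arguments.
Unset Strict Implicit.
Unset Printing Implicit Defensive.

(* A graph on the vertex set T is represented by its edge set, a set of
   2-element subsets of T.  Subgraphs are subsets of the edge set: isolated
   vertices belong to no cycle and carry no edge, so the vertex set of a
   subgraph affects neither its chordality nor its number of edges. *)
Definition sgraph (T : finType) (G : {set {set T}}) : bool :=
  [forall e in G, #|e| == 2].

Definition adj (T : finType) (G : {set {set T}}) (x y : T) : bool :=
  [set x; y] \in G.

(* c lists, in cyclic order, the vertices of an induced cycle of G of length
   at least 3; lengths below 3 are not meaningful. *)
Definition induced_cycle (T : finType) (G : {set {set T}}) (c : seq T) : bool :=
  uniq c &&
  [forall x in c, forall y in c,
     adj G x y == ((y == next c x) || (x == next c y))].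

(* The bound on the length makes the definition boolean; it is harmless
   since a cycle has distinct vertices, see chordalP. *)
Definition chordal (T : finType) (G : {set {set T}}) : bool :=
  [forall l : 'I_#|T|.+1, (4 <= l) ==>
     [forall c : l.-tuple T, ~~ induced_cycle G c]].

Lemma chordalP (T : finType) (G : {set {set T}}) :
  reflect (forall c : seq T, 4 <= size c -> ~~ induced_cycle G c) (chordal G).
Proof.
apply: (iffP forallP) => [chG c c4 | chG l]; last first.
  apply/implyP=> l4; apply/forallP=> c.
  by apply: chG; rewrite size_tuple.
apply/negP=> indc; have /andP[Uc _] := indc.
have lec : size c < #|T|.+1 by rewrite ltnS -(card_uniqP Uc) max_card.
have /implyP/(_ c4)/forallP/(_ (in_tuple c)) := chG (Ordinal lec).
by rewrite indc.
Qed.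

Definition chordal_guarantee (n m j : nat) : bool :=
  [forall G : {set {set 'I_n}}, sgraph G && (#|G| == m) ==>
     [exists H : {set {set 'I_n}},
        [&& H \subset G, chordal H & j <= #|H|]]].

(* A subgraph of a graph with m edges has at most m edges, so for
   m <= 'C(n, 2) restricting the maximum to j <= m loses nothing, see leq_f. *)
Definition f (n m : nat) : nat :=
  \max_(j < m.+1 | chordal_guarantee n m j) j.

Lemma leq_f (n m j : nat) : m <= 'C(n, 2) ->
  (j <= f n m) = chordal_guarantee n m j.
Proof.
move=> mn.
have mono i i' : i <= i' -> chordal_guarantee n m i' -> chordal_guarantee n m i.
  move=> le_ii' /forallP gi'; apply/forallP=> G; apply/implyP=> hG.
  have /implyP/(_ hG)/existsP[H /and3P[sHG chH leH]] := gi' G.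
  by apply/existsP; exists H; rewrite sHG chH (leq_trans le_ii').
have g0 : chordal_guarantee n m 0.
  apply/forallP=> G; apply/implyP=> _; apply/existsP; exists set0.
  rewrite sub0set leq0n andbT /=; apply/chordalP=> -[|x c] //= _.
  apply/negP=> /andP[_ /forall_inP/(_ x (mem_head x c))].
  move/forall_inP/(_ (next (x :: c) x)).
  by rewrite mem_next mem_head => /(_ isT); rewrite /adj inE eqxx.
have guaranteeW : chordal_guarantee n m j -> j <= m.
  pose K := [set e : {set 'I_n} | #|e| == 2].
  have cK : #|K| = 'C(n, 2) by rewrite card_draws card_ord.
  move=> /forallP.
  have mK : m <= size (enum K) by rewrite -cardE cK.
  pose G := [set e in take m (enum K)].
  have cG : #|G| = m.
    rewrite cardsE (card_uniqP _) ?take_uniq ?enum_uniq //.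
    by rewrite size_takel.
  have sG : sgraph G.
    by apply/forall_inP=> e; rewrite inE => /mem_take; rewrite mem_enum inE.
  move/(_ G); rewrite sG cG eqxx => /existsP[H /and3P[sHG _ /leq_trans]].
  by apply; rewrite -cG subset_leq_card.
apply/idP/idP => [le_jf | gj].
  apply: mono le_jf _; rewrite /f.
  by apply: (big_ind (chordal_guarantee n m)) => // x y gx gy; rewrite /maxn; case: ifP.
by rewrite /f (bigmax_sup (Ordinal (guaranteeW gj : j < m.+1))).
Qed.

(* The parts are the residue classes modulo k (for 0 < k): their sizes differ
   by at most one, and some of them are empty when n < k. *)
Definition turan_graph (k n : nat) : {set {set 'I_n}} :=
  [set [set p.1; p.2] | p : 'I_n * 'I_n & p.1 %% k != p.2 %% k].

Definition turan_size (k n : nat) : nat := #|turan_graph k n|.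

(* Main.v *)
(* Lower bound.  Let mu = 1 - 1/k, let n' be the number of vertices of a graph, and
   let x be its excess: k x^2 / (k + 1) is twice the number of edges beyond
   mu n'^2 / 2.  If all the vertices of a (k+1)-clique have degree at least
   mu n' + x / (k + 1), then joining every vertex to its neighbours in the clique
   gives a chordal graph with (k - 1/k) n' + x edges, up to a constant.  Deleting a
   vertex of smaller degree lowers x by at most 1/k, up to lower order terms, so it
   is affordable if the vertex can later be attached by k edges.  Vertices of small
   degree are attached in bulk: by the Moon-Moser inequality, either some
   (k+1)-clique avoids them, or some k-clique has many of them, of order x / sqrt n,
   as common neighbours; these become the leaves of a star joined to that k-clique,
   and the loss of a constant for each star is compensated by lowering the degree
   threshold by a multiple of sqrt n.

   Upper bound.  By Dirac's theorem a chordal graph can be dismantled by deleting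
   simplicial vertices.  In a subgraph of a properly (k+1)-coloured graph, such a
   vertex has degree at most k, and at most k - 1 if its neighbours avoid two
   colours.  The graphs used have about n/k - x vertices of the latter kind. *)

Require Import Defs.
From mathcomp Require Import all_boot all_order all_algebra.
From mathcomp Require Import reals.
From mathcomp Require Import ring lra zify.
Import Order.TTheory GRing.Theory Num.Theory.
Local Open Scope ring_scope.

Set Implicit Arguments.
Unset Strict Implicit.
Unset Printing Implicit Defensive.

(** * Counting cliques *)

Section Cliques.

Variables (T : finType) (e : rel T).
Hypotheses (e_irr : irreflexive e) (e_sym : symmetric e).

Definition clique (K : {set T}) : bool :=
  [forall u in K, forall v in K, (u != v) ==> e u v].

Lemma cliqueP (K : {set T}) :
  reflect {in K &, forall u v, u != v -> e u v} (clique K).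
Proof.
apply: (iffP forall_inP) => [h u v uK vK uv | h u uK].
  by have /forall_inP/(_ v vK)/implyP/(_ uv) := h u uK.
by apply/forall_inP => v vK; apply/implyP => uv; apply: h.
Qed.

Definition cliques (A : {set T}) (s : nat) : {set {set T}} :=
  [set K : {set T} | [&& K \subset A, #|K| == s & clique K]].

Definition joint (A P : {set T}) : {set T} := [set u in A | [forall p in P, e u p]].

Lemma jointP (A P : {set T}) (u : T) :
  reflect (u \in A /\ forall p, p \in P -> e u p) (u \in joint A P).
Proof. by rewrite inE; apply: (iffP andP) => -[-> /forall_inP]. Qed.

Lemma joint_notin (A P : {set T}) (u : T) : u \in joint A P -> u \notin P.
Proof. by move=> /jointP[_ h]; apply/negP => /h; rewrite e_irr. Qed.

(** Double counting: an $(s+1)$-clique with a marked vertex is an $s$-clique together with one of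
    its common neighbours. *)
Lemma cliques_sum (V : nmodType) (A : {set T}) (s : nat) (F : {set T} -> T -> V) :
  \sum_(K in cliques A s.+1) \sum_(v in K) F (K :\ v) v =
  \sum_(P in cliques A s) \sum_(v in joint A P) F P v.
Proof.
rewrite !pair_big_dep /=.
rewrite (reindex_onto (fun q : {set T} * T => (q.2 |: q.1, q.2))
                      (fun q : {set T} * T => (q.1 :\ q.2, q.2))) /=; last first.
  by move=> [K v] /= /andP[_ vK]; rewrite setD1K.
apply: eq_big => [[P v] | [P v]] /=; last first.
  by move=> /andP[_]; rewrite xpair_eqE => /andP[/eqP-> _].
rewrite !inE eqxx orTb xpair_eqE eqxx !andbT -!andbA.
apply/idP/idP.
  case/and4P=> sub card cl /eqP eqP_.
  have vP : v \notin P by rewrite -eqP_ !inE eqxx.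
  move: card; rewrite cardsU1 vP add1n eqSS => ->.
  move: sub; rewrite subUset sub1set => /andP[-> ->] /=.
  move/cliqueP: cl => cl.
  apply/andP; split; first by apply/cliqueP => a b aP bP; apply: cl; rewrite ?inE ?aP ?bP orbT.
  apply/forall_inP => p pP; apply: cl; rewrite ?inE ?eqxx ?pP ?orbT //.
  by apply: contraNneq vP => ->.
case/and5P=> sub card /cliqueP cl vA vj.
have vP : v \notin P by apply: (@joint_notin A); rewrite inE vA.
move/forall_inP: vj => vj.
rewrite setU1K // eqxx andbT subUset sub1set vA sub cardsU1 vP (eqP card) eqxx /=.
apply/cliqueP => a b; rewrite !inE => /orP[/eqP->|aP] /orP[/eqP->|bP] ab.
- by rewrite eqxx in ab.
- exact: vj.
- by rewrite e_sym; apply: vj.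
- exact: cl.
Qed.

(** A vertex of [A] joined to all of [K] is counted for each of the [s.+1] choices of [v]; one that
    misses some [p0] in [K] can be counted only for [v = p0]. *)
Lemma joint_sum_le (A K : {set T}) (s : nat) : K \in cliques A s.+1 ->
  (\sum_(v in K) #|joint A (K :\ v)| <= #|A| + s * #|joint A K|)%N.
Proof.
rewrite inE => /and3P[KA /eqP cK clK].
have cardE (P : {set T}) : #|joint A P| = (\sum_(u in A) [forall p in P, e u p])%N.
  rewrite -sum1_card big_mkcond [RHS]big_mkcond /=.
  by apply: eq_bigr => u _; rewrite inE; case: (u \in A); case: [forall _ in _, _].
rewrite (eq_bigr _ (fun v _ => cardE (K :\ v))) exchange_big /= cardE big_distrr /=.
rewrite -sum1_card -big_split /=; apply: leq_sum => u uA.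
case: forall_inP => [h | nh] /=.
  rewrite muln1 add1n -cK -sum1_card; apply: leq_sum => v vK; exact: leq_b1.
rewrite muln0 addn0.
have [p0 p0K np0] : exists2 p, p \in K & ~~ e u p.
  apply/exists_inP; rewrite -negb_forall_in; apply/negP => /forall_inP; exact: nh.
rewrite (bigD1 p0) //= big1 ?addn0 ?leq_b1 // => v /andP[vK vp].
apply/eqP; rewrite eqb0; apply/negP => /forall_inP/(_ p0).
by rewrite !inE eq_sym vp p0K (negPf np0) => /(_ isT).
Qed.

(** Ordered adjacent pairs, hence twice the number of edges inside [A]. *)
Definition arcs (A : {set T}) : nat := (\sum_(u in A) #|[set v in A | e u v]|)%N.

Lemma card_cliques0 (A : {set T}) : #|cliques A 0| = 1%N.
Proof.
rewrite (_ : cliques A 0 = [set set0]) ?cards1 //.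
apply/setP => K; rewrite !inE cards_eq0 andbCA; case: eqP => //= ->.
by rewrite sub0set; apply/cliqueP => u v; rewrite inE.
Qed.

Lemma card_cliquesS (R : numDomainType) (A : {set T}) (s : nat) :
  s.+1%:R * #|cliques A s.+1|%:R = \sum_(P in cliques A s) #|joint A P|%:R :> R.
Proof.
transitivity (\sum_(K in cliques A s.+1) \sum_(v in K) (1 : R)).
  rewrite (eq_bigr (fun=> s.+1%:R)) ?sumr_const ?mulr_natr //.
  by move=> K; rewrite inE sumr_const => /and3P[_ /eqP-> _].
rewrite (cliques_sum A s (fun _ _ => 1)).
by apply: eq_bigr => P _; rewrite sumr_const.
Qed.

Lemma card_cliques1 (A : {set T}) : #|cliques A 1| = #|A|.
Proof.
have := card_cliquesS int A 0; rewrite mul1r (eq_bigr (fun=> #|A|%:R)).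
  by rewrite sumr_const card_cliques0 mulr1n => /eqP; rewrite eqr_nat => /eqP.
move=> P; rewrite inE cards_eq0 => /and3P[_ /eqP-> _]; congr (#|pred_of_set _|%:R).
by apply/setP => u; rewrite inE andb_idr // => _; apply/forall_inP => p; rewrite inE.
Qed.

Lemma sum_cliques1 (V : nmodType) (A : {set T}) (F : {set T} -> V) :
  \sum_(P in cliques A 1) F P = \sum_(u in A) F [set u].
Proof.
transitivity (\sum_(K in cliques A 1) \sum_(v in K) F ((K :\ v) :|: [set v])).
  apply: eq_bigr => K; rewrite inE => /and3P[_ /cards1P[v ->] _].
  by rewrite big_set1 setDv set0U.
rewrite (cliques_sum A 0 (fun P v => F (P :|: [set v]))).
rewrite (big_pred1 set0) => [|P]; last first.
  rewrite inE cards_eq0 andbCA /=; case: eqP => //= ->.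
  by rewrite sub0set; apply/cliqueP => u v; rewrite inE.
apply: eq_big => [u | u _]; last by rewrite set0U.
by rewrite inE andb_idr // => _; apply/forall_inP => p; rewrite inE.
Qed.

Lemma card_cliques2 (R : numDomainType) (A : {set T}) :
  2 * #|cliques A 2|%:R = (arcs A)%:R :> R.
Proof.
rewrite (card_cliquesS R A 1) sum_cliques1 /arcs natr_sum.
apply: eq_bigr => u _; congr (#|pred_of_set _|%:R).
apply/setP => v; rewrite !inE; congr (_ && _).
apply/forall_inP/idP => [/(_ u) | euv p].
  by rewrite e_sym; apply; rewrite inE.
by rewrite inE => /eqP->; rewrite e_sym.
Qed.

(* Moon and Moser's inequality; the tangent at [lam] replaces Cauchy-Schwarz and
   avoids dividing by numbers of cliques. *)
Lemma moon_moser_step (R : realFieldType) (A : {set T}) (s : nat) (lam : R) :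
  0 <= lam ->
  lam * #|cliques A s|%:R <= s.+1%:R * #|cliques A s.+1|%:R ->
  (s.+1%:R * lam - #|A|%:R) * #|cliques A s.+1|%:R <=
    s%:R * (s.+2%:R * #|cliques A s.+2|%:R).
Proof.
move=> lam0; rewrite !card_cliquesS => hlam.
have lower : lam * \sum_(P in cliques A s) #|joint A P|%:R <=
    \sum_(P in cliques A s) (#|joint A P|%:R ^+ 2 : R).
  have : 0 <= \sum_(P in cliques A s) (#|joint A P|%:R - lam : R) ^+ 2.
    by apply: sumr_ge0 => P _; apply: sqr_ge0.
  rewrite (eq_bigr (fun P : {set T} => #|joint A P|%:R ^+ 2 - (2 * lam) * #|joint A P|%:R + lam ^+ 2)); last first.
    by move=> P _; ring.
  rewrite big_split /= sumrB sumr_const -mulr_sumr -mulr_natr.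
  move: hlam; set S := \sum_(P in _) _; set N := _%:R; set Q := \sum_(P in _) _.
  move=> hlam h; have : 0 <= lam * (S - lam * N) by rewrite mulr_ge0 // subr_ge0.
  by move: h; rewrite expr2; nra.
(* Each square is a sum over the common neighbours [v] of [P]; regrouped by the larger clique
   $P\cup\{v\}$, the terms are those of [joint_sum_le]. *)
have upper : \sum_(P in cliques A s) (#|joint A P|%:R ^+ 2 : R) <=
    #|A|%:R * #|cliques A s.+1|%:R + s%:R * \sum_(K in cliques A s.+1) #|joint A K|%:R.
  rewrite (eq_bigr (fun P : {set T} => \sum_(v in joint A P) #|joint A P|%:R)); last first.
    by move=> P _; rewrite sumr_const -[RHS]mulr_natr expr2.
  rewrite -(cliques_sum A s (fun P _ => #|joint A P|%:R)) mulr_natr -sumr_const mulr_sumr -big_split /=.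
  apply: ler_sum => K hK; have := joint_sum_le hK.
  by rewrite -(ler_nat R) natrD natrM natr_sum.
have := le_trans lower upper.
rewrite -(card_cliquesS R A s); nra.
Qed.

(** By induction on $s$, an $s$-clique has on average at least [lam s] common neighbours. The
    hypothesis on [arcs] is the case $s=1$, and $(s+2)\,lam(s+1)-|A|=(s+1)\,lam(s+2)$ turns
    [moon_moser_step] into the induction step. At $s=k$ only $k\,be$ is left. *)
Lemma moon_moser (R : realFieldType) (A : {set T}) (k : nat) (be : R) :
  (0 < k)%N -> 0 < be -> (0 < #|A|)%N ->
  ((1 - 1 / k%:R) * #|A|%:R + be) * #|A|%:R <= (arcs A)%:R ->
  (0 < #|cliques A k|)%N /\
  k%:R * be * #|cliques A k|%:R <= k.+1%:R * #|cliques A k.+1|%:R.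
Proof.
move=> k0 be0 A0 hA; have kR : 0 < k%:R :> R by rewrite ltr0n.
pose lam (s : nat) : R := (1 - s%:R / k%:R) * #|A|%:R + s%:R * be.
have AR : 0 < #|A|%:R :> R by rewrite ltr0n.
have lam_gt0 s : (s <= k)%N -> 0 < lam s.
  move=> sk; rewrite /lam; have : 0 <= 1 - s%:R / k%:R :> R.
    by rewrite subr_ge0 ler_pdivrMr // mul1r ler_nat.
  case: s sk => [|s] sk h; first by rewrite !mul0r subr0 mul1r addr0.
  apply: ltr_wpDl; first by rewrite mulr_ge0 // ltW.
  by rewrite mulr_gt0 // ltr0n.
have key s : (s <= k)%N -> (0 < #|cliques A s|)%N /\
    lam s * #|cliques A s|%:R <= s.+1%:R * #|cliques A s.+1|%:R.
  elim: s => [|s IH] sk.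
    by rewrite card_cliques0 card_cliques1 /lam !mul0r subr0 addr0 mulr1 mul1r.
  have [Ns hs] := IH (ltnW sk).
  have Ns1 : (0 < #|cliques A s.+1|)%N.
    rewrite -(ltr0n R) -(pmulr_rgt0 _ (ltr0Sn R s)).
    apply: lt_le_trans hs; rewrite mulr_gt0 ?ltr0n // lam_gt0 //; exact: ltnW.
  split=> //; case: s sk IH Ns hs Ns1 => [|s] sk IH Ns hs Ns1.
    by rewrite card_cliques1 card_cliques2 /lam !mul1r; move: hA; rewrite mul1r.
  have := moon_moser_step (ltW (lam_gt0 _ (ltnW sk))) hs.
  have -> : s.+2%:R * lam s.+1 - #|A|%:R = s.+1%:R * lam s.+2.
    rewrite /lam -[s.+2]addn2 -[s.+1]addn1 !natrD; field; exact: lt0r_neq0.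
  by rewrite -mulrA ler_pM2l ?ltr0n.
by have [? h] := key k (leqnn k); split=> //; move: h; rewrite /lam divff ?gt_eqF // subrr mul0r add0r.
Qed.

(** If every $(k+1)$-clique meets [B], each yields a $k$-clique with a common neighbour in [B]. By
    [moon_moser] there are at least $\frac{k}{k+1}\,be\ge be/2$ times as many $(k+1)$-cliques as
    $k$-cliques, so some $k$-clique attains the average. *)
Lemma exists_clique_joint (R : realFieldType) (A B : {set T}) (k : nat) (be : R) :
  (0 < k)%N -> 0 < be -> (0 < #|A|)%N ->
  ((1 - 1 / k%:R) * #|A|%:R + be) * #|A|%:R <= (arcs A)%:R ->
  (forall K, K \in cliques A k.+1 -> ~~ [disjoint K & B]) ->
  exists2 Q, Q \in cliques A k & be / 2 <= #|joint A Q :&: B|%:R.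
Proof.
move=> k0 be0 A0 hA hB; have [Nk hk] := moon_moser k0 be0 A0 hA.
apply/exists_inP; apply: contraT => /exists_inPn noQ.
have up : #|cliques A k.+1|%:R <= \sum_(Q in cliques A k) (#|joint A Q :&: B|%:R : R).
  rewrite (eq_bigr (fun Q : {set T} => \sum_(v in joint A Q) (v \in B)%:R)); last first.
    move=> Q _; rewrite -sum1_card natr_sum big_mkcond [RHS]big_mkcond /=.
    by apply: eq_bigr => v _; rewrite inE; case: (v \in joint _ _); case: (v \in B).
  rewrite -(cliques_sum A k (fun _ v => (v \in B)%:R)) -sum1_card natr_sum.
  apply: ler_sum => K /hB; rewrite -setI_eq0 => /set0Pn[v]; rewrite inE => /andP[vK vB].
  by rewrite (bigD1 v) //= vB lerDl; apply: sumr_ge0 => u _; apply: ler0n.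
have lt : \sum_(Q in cliques A k) (#|joint A Q :&: B|%:R : R) < be / 2 * #|cliques A k|%:R.
  rewrite mulr_natr -sumr_const; apply: ltr_sum; last first.
    by move=> Q /noQ; rewrite -ltNge.
  by have /card_gt0P[Q QK] := Nk; apply/hasP; exists Q; rewrite ?mem_index_enum.
have N0 : 0 < #|cliques A k|%:R :> R by rewrite ltr0n.
have k1 : 1 <= k%:R :> R by rewrite ler1n.
move: hk up lt; rewrite -[k.+1%:R]natr1.
set x := #|cliques A k|%:R in N0 *; set y := #|cliques A k.+1|%:R; set z := \sum_(_ in _) _.
move=> hk up lt; have h1 : y < be / 2 * x by lra.
have h2 : (k%:R + 1) * y < (k%:R + 1) * (be / 2 * x) by rewrite ltr_pM2l //; lra.
have h3 : 0 <= (k%:R - 1) * (be * x) by rewrite mulr_ge0 ?subr_ge0 // ltW // mulr_gt0.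
by exfalso; nra.
Qed.

End Cliques.

(** * Chordal graphs *)

Section Chordal.

Variable T : finType.
Implicit Types (G H : {set {set T}}) (A B K S Z : {set T}).

Lemma set2_inj (x y u v : T) :
  ([set x; y] == [set u; v]) =
    (x == u) && (y == v) || (x == v) && (y == u).
Proof.
apply/eqP/orP => [E | [] /andP[/eqP-> /eqP->] //]; last by rewrite setUC.
have : x \in [set u; v] by rewrite -E !inE eqxx.
have : y \in [set u; v] by rewrite -E !inE eqxx orbT.
have : u \in [set x; y] by rewrite E !inE eqxx.
have : v \in [set x; y] by rewrite E !inE eqxx orbT.
rewrite !inE; do 4 ! case/orP => /eqP ?; subst; rewrite ?eqxx ?orbT; auto.
Qed.

Lemma adj_sym G : symmetric (adj G).
Proof. by move=> x y; rewrite /adj setUC. Qed.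

Lemma adj_irr G : sgraph G -> irreflexive (adj G).
Proof.
move=> /forall_inP sG x; apply/negP; rewrite /adj setUid => /sG.
by rewrite cards1.
Qed.

Lemma adj_sub H G x y : H \subset G -> adj H x y -> adj G x y.
Proof. by move=> /subsetP; apply. Qed.

Lemma cliques_adj2 G : sgraph G -> cliques (adj G) [set: T] 2 = G.
Proof.
move=> sG; apply/setP => K; rewrite inE subsetT /=; apply/andP/idP.
  case=> /cards2P[x [y [xy ->]]] /cliqueP h.
  by apply: (h x y) => //; rewrite !inE eqxx ?orbT.
move=> KG; have /forall_inP/(_ K KG) K2 := sG; split=> //.
have /cards2P[x [y [xy E]]] := K2; apply/cliqueP => u v.
rewrite E !inE => /orP[] /eqP-> /orP[] /eqP->; rewrite ?eqxx //.
  by rewrite /adj -E.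
by rewrite adj_sym /adj -E.
Qed.

Lemma handshake (R : numDomainType) G : sgraph G ->
  2 * #|G|%:R = (arcs (adj G) [set: T])%:R :> R.
Proof.
by move=> sG; rewrite -(card_cliques2 (adj_irr sG) (@adj_sym G)) cliques_adj2.
Qed.

Definition edges (r : rel T) : {set {set T}} :=
  [set [set p.1; p.2] | p : T * T & r p.1 p.2].

Lemma adj_edges (r : rel T) x y : adj (edges r) x y = r x y || r y x.
Proof.
apply/imsetP/orP => [[[u v] ruv /eqP] | [h|h]].
- move: ruv; rewrite inE /= set2_inj => ruv.
  by case/orP=> /andP[/eqP-> /eqP->]; auto.
- by exists (x, y); rewrite ?inE.
- by exists (y, x); rewrite ?inE //= setUC.
Qed.

Lemma sgraph_edges (r : rel T) : irreflexive r -> sgraph (edges r).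
Proof.
move=> rI; apply/forall_inP => _ /imsetP[[u v] + ->]; rewrite inE /= => ruv.
by rewrite cards2; case: (eqVneq u v) ruv => // ->; rewrite rI.
Qed.

Lemma induced_cycle_nbrs G (c : seq T) x :
  induced_cycle G c -> (4 <= size c)%N -> x \in c ->
  exists p q, [/\ p \in c, q \in c, adj G x p, adj G x q & (p != q) && ~~ adj G p q].
Proof.
(* Rotate the cycle to start at [x]; then [q] is its second entry and [p] its last. *)
move=> /andP[Uc /forall_inP ind] c4 xc.
have /rot_to[i s Es] := xc.
have memE y : (y \in c) = (y \in x :: s) by rewrite -Es mem_rot.
have nextE y : next c y = next (x :: s) y by rewrite -Es next_rot.
have Us : uniq (x :: s) by rewrite -Es rot_uniq.
have s4 : (4 <= size (x :: s))%N by rewrite -Es size_rot.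
have adjE u v : u \in x :: s -> v \in x :: s ->
    adj G u v = (v == next (x :: s) u) || (u == next (x :: s) v).
  rewrite -!memE -!nextE => uc vc.
  by apply/eqP; have /forall_inP/(_ v vc) := ind u uc.
case: s {Es} memE nextE Us s4 adjE => [|q [|y s]] // memE nextE Us s4 adjE.
have s0 : s != [::] by case: s s4 {memE nextE Us adjE}.
have pE : exists s' p, s = rcons s' p.
  by case/lastP: s s0 {memE nextE Us s4 adjE} => // s' p; exists s', p.
case: pE => s' [p E]; subst s.
have pc : p \in [:: x, q, y & rcons s' p] by rewrite !inE mem_rcons inE eqxx !orbT.
have qc : q \in [:: x, q, y & rcons s' p] by rewrite !inE eqxx !orbT.
have xc' : x \in [:: x, q, y & rcons s' p] by rewrite !inE eqxx.
move: (Us); rewrite /= !in_cons !negb_or -!andbA.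
case/and5P=> xq xy xs qy /and3P[qs ys Us'].
have nx : next [:: x, q, y & rcons s' p] x = q by rewrite /= eqxx.
have qp : q != p by apply: contraNneq qs => ->; rewrite mem_rcons mem_head.
have nq : next [:: x, q, y & rcons s' p] q = y by rewrite /= eq_sym (negPf xq) eqxx.
have np : next [:: x, q, y & rcons s' p] p = x.
  have ip : index p (rcons [:: x, q, y & s'] p) = (size s').+3.
    have Ur : uniq (rcons [:: x, q, y & s'] p) by exact: Us.
    move: Ur; rewrite rcons_uniq => /andP[pn _].
    by rewrite -cats1 index_cat (negPf pn) index_head addn0.
  (* The index of [p] lies just beyond the end of the tail, so [nth] returns its default [x]: the
     cycle closes up. *)
  rewrite next_nth pc.
  rewrite -[X in index p X]/(rcons [:: x, q, y & s'] p) ip.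
  by rewrite nth_default // -[[:: q, y & _]]/(rcons [:: q, y & s'] p) size_rcons.
exists p, q; rewrite !memE; split=> //.
- by rewrite adjE // np eqxx orbT.
- by rewrite adjE // nx eqxx.
rewrite eq_sym qp /= adjE // np nq negb_or eq_sym xq /=.
by apply: contraNneq ys => <-; rewrite mem_rcons mem_head.
Qed.

Lemma simplicial_notin_cycle G (c : seq T) x :
  (forall p q, p \in c -> q \in c -> adj G x p -> adj G x q -> p != q -> adj G p q) ->
  (4 <= size c)%N -> induced_cycle G c -> x \notin c.
Proof.
move=> simp c4 ind; apply/negP => xc.
have [p [q [pc qc xp xq /andP[pq]]]] := induced_cycle_nbrs ind c4 xc.
by rewrite simp.
Qed.

Lemma eq_induced_cycle G H (c : seq T) : {in c &, adj G =2 adj H} ->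
  induced_cycle G c = induced_cycle H c.
Proof.
move=> E; congr (_ && _); apply/forall_inP/forall_inP => h x xc;
  apply/forall_inP => y yc; have /forall_inP/(_ y yc) := h x xc; rewrite E //.
Qed.

Definition nbrs G K u : {set T} := [set v in K | adj G u v].

(* Every vertex that gets a new edge, except possibly one vertex of [K], was
   isolated in [H]: it becomes simplicial, so no long induced cycle contains it. *)
Lemma star_extension G H Z K S :
  H \subset G -> chordal H -> clique (adj G) K ->
  {in K &, forall u v, u \in Z -> v \in Z -> u = v} ->
  [disjoint S & K] -> [disjoint S & Z] ->
  (forall u v, u \in K :|: S -> u \notin Z -> ~~ adj H u v) ->
  exists H', [/\ H' \subset G, chordal H',
    (#|H| + \sum_(s in S) #|nbrs G K s| <= #|H'|)%N &
    forall u, u \notin K :|: S -> (forall v, ~~ adj H u v) -> forall v, ~~ adj H' u v].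
Proof.
move=> HG chH /cliqueP clK KZ SK SZ iso.
pose r1 x y := [&& x \in K, y \in K & x != y].
pose r2 x y := (x \in S) && (y \in nbrs G K x).
pose H' := H :|: edges r1 :|: edges r2.
have adjE x y : adj H' x y = [|| adj H x y, r1 x y, r2 x y | r2 y x].
  rewrite /adj !inE -!/(adj _ _ _) !adj_edges -!orbA; congr (_ || _).
  by rewrite orbA [r1 y x](_ : _ = r1 x y) ?orbb // /r1 eq_sym andbCA.
have SnK s : s \in S -> s \notin K by move=> sS; rewrite (disjointFr SK sS).
have SnZ s : s \in S -> s \notin Z by move=> sS; rewrite (disjointFr SZ sS).
exists H'; split.
- rewrite !subUset HG /=; apply/andP; split; apply/subsetP => _ /imsetP[[x y] + ->].
    by rewrite inE /= => /and3P[xK yK xy]; apply: clK.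
  by rewrite inE /r2 inE /= => /and3P[].
- apply/chordalP => c c4; apply/negP => ind.
  (* A vertex of [S] has all its neighbours in the clique [K], so it is simplicial. *)
  have cS s : s \in S -> s \notin c.
    move=> sS; apply: simplicial_notin_cycle c4 ind => p q _ _.
    have nb y : adj H' s y -> y \in K.
      rewrite adjE /r1 /r2 (negPf (SnK s sS)) sS /=.
      rewrite (negPf (iso s y _ (SnZ s sS))) ?inE ?sS ?orbT //=.
      by rewrite (negPf (SnK s sS)) /= andbF orbF => /andP[].
    by move=> /nb pK /nb qK pq; rewrite adjE /r1 pK qK pq !orbT.
  (* Now that [S] is known to avoid the cycle, a vertex of [K] outside [Z] sees only vertices of [K]
     on it. *)
  have cK u : u \in K -> u \notin Z -> u \notin c.
    move=> uK uZ; apply: simplicial_notin_cycle c4 ind => p q pc qc.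
    have uS : u \notin S by apply: contraL uK => /SnK.
    have nb y : y \in c -> adj H' u y -> y \in K.
      move=> yc; have yS : y \notin S by apply: contraL yc => /cS.
      rewrite adjE /r1 /r2 (negPf uS) (negPf yS) /= !orbF.
      by rewrite (negPf (iso u y _ uZ)) ?inE ?uK //= => /andP[].
    by move=> /(nb _ pc) pK /(nb _ qc) qK pq; rewrite adjE /r1 pK qK pq !orbT.
  (* A new edge with both ends on [c] would join two vertices of [K] in [Z], and there is at most
     one such vertex. *)
  have : induced_cycle H c.
    rewrite -(@eq_induced_cycle H' H) // => x y xc yc.
    have xS : x \notin S by apply: contraL xc => /cS.
    have yS : y \notin S by apply: contraL yc => /cS.
    rewrite adjE /r1 /r2 (negPf xS) (negPf yS) /= !orbF orb_idr //.
    case/and3P=> xK yK /eqP[]; apply: KZ => //.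
      by apply: contraLR xc; apply: cK.
    by apply: contraLR yc; apply: cK.
  by apply/negP; move/chordalP: chH; apply.
- have dis : [disjoint H & edges r2].
    rewrite disjoint_sym; apply/pred0Pn => -[E /= /andP[/imsetP[[x y] + ->]]].
    rewrite inE /= => /andP[xS _] h.
    by have /negP := iso x y (subsetP (subsetUr _ _) _ xS) (SnZ _ xS).
  have cE2 : #|edges r2| = (\sum_(s in S) #|nbrs G K s|)%N.
    rewrite card_in_imset; last first.
      move=> [x y] [u v]; rewrite !inE /r2 !inE /= => /and3P[xS yK _] /and3P[uS vK _] /eqP.
      rewrite set2_inj => /orP[] /andP[/eqP xu /eqP yv]; first by rewrite xu yv.
      by move: vK; rewrite -xu (negPf (SnK x xS)).
    rewrite -sum1_card (eq_bigr (fun s => \sum_(v in nbrs G K s) 1))%N; last by move=> *; rewrite sum1_card.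
    by rewrite pair_big_dep /=; apply: eq_bigl => -[x y]; rewrite inE.
  rewrite -cE2; have -> : (#|H| + #|edges r2| = #|H :|: edges r2|)%N.
    by rewrite cardsU (disjoint_setI0 dis) cards0 subn0.
  by apply: subset_leq_card; rewrite /H' setUAC subsetUl.
- move=> u; rewrite inE => /norP[uK uS] isoH v.
  by rewrite adjE /r1 /r2 (negPf uK) (negPf uS) (negPf (isoH v)) /= inE (negPf uK) /= andbF.
Qed.

Lemma chordal0 : chordal (set0 : {set {set T}}).
Proof.
apply/chordalP => c c4; apply/negP => ind.
case: c c4 ind => // x c c4 ind.
have [p [q [_ _]]] := induced_cycle_nbrs ind c4 (mem_head x c).
by rewrite /adj inE.
Qed.

End Chordal.

(** * Simplicial vertices and the size of chordal graphs *)

Section Dirac.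

Variable T : finType.
Implicit Types (H : {set {set T}}) (W X : {set T}).

Lemma next_nth_uniq (x0 : T) (c : seq T) i : uniq c -> (i < size c)%N ->
  next c (nth x0 c i) = nth x0 c (if i.+1 == size c then 0%N else i.+1).
Proof.
move=> Uc ic; rewrite next_nth mem_nth // index_uniq //.
case: c Uc ic => // x c Uc; rewrite ltnS => ic /=.
rewrite eqSS; have [-> | ne] := eqVneq i (size c); first by rewrite nth_default.
by rewrite (set_nth_default x0) //= ltn_neqAle ne.
Qed.

Lemma induced_cycleI H (x0 : T) (c : seq T) : sgraph H -> uniq c -> (2 < size c)%N ->
  (forall i j, (i < j < size c)%N ->
     adj H (nth x0 c i) (nth x0 c j) =
       (j == i.+1) || (i == 0%N) && (j.+1 == size c)) ->
  induced_cycle H c.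
Proof.
move=> sH Uc c3 h; rewrite /induced_cycle Uc /=.
apply/forall_inP => _ /(nthP x0)[i ic <-]; apply/forall_inP => _ /(nthP x0)[j jc <-].
wlog ij : i j ic jc / (i <= j)%N.
  move=> wl; case/orP: (leq_total i j) => ij; first exact: wl.
  by rewrite adj_sym orbC; apply: wl.
have nlt l : (l < size c)%N -> ((if l.+1 == size c then 0 else l.+1) < size c)%N.
  by move: (size c) => m; case: (eqVneq l.+1 m) => ?; lia.
rewrite !next_nth_uniq // !nth_uniq ?nlt //.
apply/eqP; move: ij; rewrite leq_eqVlt => /orP[/eqP <- | ij].
  rewrite (adj_irr sH) orbb; apply/esym; move: c3; move: (size c) => m c3.
  by case: (eqVneq i.+1 m) => ?; lia.
rewrite h ?ij //; move: jc; move: (size c) => m jc.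
rewrite [i.+1 == m](_ : _ = false); last lia.
case: (eqVneq j.+1 m) => _; rewrite ?andbT // andbF orbF.
by rewrite [i == j.+1](_ : _ = false) ?orbF //; lia.
Qed.

(** A chord bypasses the vertices between its ends, so a shortest path has none. Positions are
    counted in [y :: s], which is why [s] is cut at [j.-1]. *)
Lemma path_shortcut (e : rel T) (y : T) (s : seq T) i j :
  path e y s -> (i.+1 < j <= size s)%N ->
  e (nth y (y :: s) i) (nth y (y :: s) j) ->
  let s' := take i s ++ drop j.-1 s in
  [/\ path e y s', last y s' = last y s, (size s' < size s)%N & subseq s' s].
Proof.
move=> ps /andP[ij js] eij s'.
have j0 : (0 < j)%N by lia.
have lt : last y (take i s) = nth y (y :: s) i.
  rewrite (last_nth y) size_takel; last lia.
  by case: i ij eij s' => //= i ij _ _; rewrite nth_take.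
have dj : drop j.-1 s = nth y (y :: s) j :: drop j s.
  by case: j ij js eij j0 s' => //= j ij js _ _ _; rewrite (drop_nth y).
have pt : path e y (take i s) by move: ps; rewrite -{1}(cat_take_drop i s) cat_path => /andP[].
have pd : path e (nth y (y :: s) j) (drop j s).
  move: ps; rewrite -{1}(cat_take_drop j.-1 s) cat_path dj /= => /andP[_ /andP[]] //.
split.
- by rewrite /s' cat_path pt lt dj /= eij.
- rewrite /s' last_cat dj /= -[in RHS](cat_take_drop j.-1 s) last_cat dj //.
- by rewrite /s' size_cat size_takel ?size_drop; lia.
- rewrite -[X in subseq _ X](cat_take_drop i s) /s'; apply: cat_subseq => //.
  rewrite -[j.-1](@subnK i) -?drop_drop ?drop_subseq //; lia.
Qed.

(** Dirac's theorem for the subgraph induced on [W], by induction on its size. If [W] is not a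
    clique, it splits into a connected set [X], its neighbourhood [Y] and a nonempty rest [Z]. A
    simplicial vertex of [Z] stays simplicial in [W] because [Y] is a clique completely joined to
    [Z]. *)
Lemma chordal_simplicial H W : sgraph H -> chordal H -> W != set0 ->
  exists2 v, v \in W & {in W &, forall p q, adj H v p -> adj H v q -> p != q -> adj H p q}.
Proof.
move=> sH /chordalP chH; have [n] := ubnP #|W|; elim: n W => // n IH W Wn W0.
have [cl | ] := boolP (clique (adj H) W).
  have /set0Pn[v vW] := W0; exists v => // p q pW qW _ _.
  by move/cliqueP: cl; apply.
rewrite negb_forall_in => /exists_inP[a aW]; rewrite negb_forall_in => /exists_inP[b bW].
rewrite negb_imply => /andP[ab nab].
have adjI := adj_irr sH.
pose rX X := [rel u v | [&& u \in X, v \in X & adj H u v]].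
have rX_sym X : connect_sym (rX X).
  by apply: sym_connect_sym => u v /=; rewrite adj_sym andbCA.
have rX_sub X X' u v : X \subset X' -> connect (rX X) u v -> connect (rX X') u v.
  move=> /subsetP XX'; apply: connect_sub => x y /and3P[xX yX xy].
  by apply: connect1; rewrite /= !XX'.
(* Connected sets containing [a] that leave some vertex of [W] outside them without a neighbour in
   them; [X] is taken maximal. *)
pose good X := [&& a \in X, X \subset W, [forall x in X, connect (rX X) a x] &
  [exists z in W :\: X, forall x in X, ~~ adj H z x]].
have ga : good [set a].
  rewrite /good inE eqxx sub1set aW /=; apply/andP; split.
    by apply/forall_inP => x; rewrite inE => /eqP->; apply: connect0.
  apply/exists_inP; exists b; first by rewrite !inE bW eq_sym ab.
  by apply/forall_inP => x; rewrite inE => /eqP->; rewrite adj_sym.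
have [X /maxsetP[/and4P[aX XW /forall_inP cX /exists_inP[z0 z0W /forall_inP z0X]] maxX] _] :=
  maxset_exists ga.
pose Y := [set y in W :\: X | [exists x in X, adj H y x]].
pose Z := W :\: X :\: Y.
have inZ z : (z \in Z) = [&& z \notin Y, z \notin X & z \in W] by rewrite !in_setD.
have nZ z x : z \in Z -> x \in X -> ~~ adj H z x.
  rewrite inE => /andP[zY zW] xX; apply: contra zY => zx.
  by rewrite inE zW; apply/exists_inP; exists x.
have z0Z : z0 \in Z.
  rewrite inE z0W andbT inE z0W /=; apply/exists_inPn => x xX; exact: z0X.
(* Otherwise [y] could be added to [X], with [z] still having no neighbour there, against
   maximality. *)
have YZ y z : y \in Y -> z \in Z -> adj H z y.
  move=> yY zZ; apply: contraT => nzy.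
  have yWX : y \in W :\: X by move: yY; rewrite inE => /andP[].
  have [x0 x0X yx0] : exists2 x, x \in X & adj H y x.
    by move: yY; rewrite inE => /andP[_ /exists_inP].
  have : good (y |: X).
    rewrite /good !inE aX orbT subUset sub1set XW.
    move: (yWX); rewrite inE => /andP[yX ->] /=; apply/andP; split.
      apply/forall_inP => x; rewrite !inE => /orP[/eqP->|xX]; last first.
        by apply: (rX_sub X); rewrite ?subsetUr ?cX.
      apply: (connect_trans (y := x0)); first by apply: (rX_sub X); rewrite ?subsetUr ?cX.
      by apply: connect1; rewrite /= !inE x0X eqxx orbT adj_sym.
    apply/exists_inP; exists z.
      move: zZ; rewrite inZ => /and3P[zY zX zW].
      by rewrite in_setD in_setU1 negb_or zX zW !andbT; apply: contraNneq zY => ->.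
    apply/forall_inP => x; rewrite !inE => /orP[/eqP->//|]; exact: nZ.
  move/maxX => /(_ (subsetUr _ _)) E; move: yWX; rewrite inE -E.
  by rewrite !inE eqxx.
(* If [y] and [y'] are not adjacent, a shortest path between them through [X] closes with [z0] to an
   induced cycle of length at least 4. *)
have YY : clique (adj H) Y.
  apply/cliqueP => y y' yY y'Y yy'; apply: contraT => nyy'.
  pose ok s := [&& path (adj H) y s, last y s == y', uniq (y :: s) &
     all (mem (y |: (y' |: X))) s].
  have [x xX yx] : exists2 x, x \in X & adj H y x.
    by move: yY; rewrite inE => /andP[_ /exists_inP].
  have [x' x'X yx'] : exists2 x, x \in X & adj H y' x.
    by move: y'Y; rewrite inE => /andP[_ /exists_inP].
  have : exists n, [exists s : n.-tuple T, ok s].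
    have /connectP[p0 pp0 lp0] : connect (rX X) x x'.
      by apply: connect_trans (cX _ x'X); rewrite rX_sym cX.
    have p0X : all (mem X) p0.
      elim: p0 x pp0 {xX yx lp0} => //= c p0 IHp x /andP[/and3P[_ cXX _] /IHp ->].
      by rewrite cXX.
    have pp1 : path (adj H) y (x :: rcons p0 y').
      rewrite /= yx rcons_path -lp0 adj_sym yx' andbT.
      by apply: sub_path pp0 => u v /and3P[].
    have : last y (x :: rcons p0 y') = y' by rewrite /= last_rcons.
    case/shortenP: pp1 => p' pp' Up' sub E.
    exists (size p'); apply/existsP; exists (in_tuple p').
    rewrite /ok pp' Up' E eqxx /=; apply/allP => u /sub.
    rewrite inE mem_rcons inE => /or3P[/eqP->|/eqP->|up0]; rewrite /= !inE ?xX ?eqxx ?orbT //.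
    by have -> : u \in X; [exact: (allP p0X) | rewrite !orbT].
  move=> exn; have [l /existsP[t okt] lmin] := ex_minnP exn.
  have {lmin} smin s : ok s -> (size t <= size s)%N.
    by move=> oks; rewrite size_tuple; apply: lmin; apply/existsP; exists (in_tuple s).
  move: okt smin; move: (tval t) => {l t exn} s /and4P[ps /eqP ls Us alls] smin.
  have z0s : z0 \notin y :: s.
    apply/negP; rewrite inE => /orP[/eqP E|].
      by move: z0Z; rewrite inE E yY.
    move/(allP alls); rewrite /= !inE => /or3P[/eqP E|/eqP E|z0X'].
    - by move: z0Z; rewrite inE E yY.
    - by move: z0Z; rewrite inE E y'Y.
    - by move: z0W; rewrite inE z0X'.
  have s2 : (1 < size s)%N.
    case: s ps ls {Us alls smin z0s} => [_ /= E|u [|v s]] //=; first by rewrite E eqxx in yy'.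
    by rewrite andbT => h E; rewrite E (negPf nyy') in h.
  have : induced_cycle H (z0 :: y :: s).
    apply: (@induced_cycleI _ y) => //.
    - by rewrite cons_uniq z0s.
    - exact: ltnW s2.
    case=> [|i] [|j] //; rewrite ltnS => /andP[ij js]; last first.
      have {}js : (j <= size s)%N by [].
      rewrite [LHS]/= eqSS orbF; have [Ej | ne] := eqVneq j i.+1.
        by move: js; rewrite Ej => js; have /(pathP y)/(_ i js) := ps.
      apply/negbTE/negP => eij.
      have ij1 : (i.+1 < j <= size s)%N by rewrite js andbT; move: ij ne; clear; lia.
      have [ps' ls' ss' sub] := path_shortcut ps ij1 eij.
      have : ok (take i s ++ drop j.-1 s).
        have Us' : uniq (y :: (take i s ++ drop j.-1 s)).
          by apply: subseq_uniq Us; rewrite /= eqxx.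
        rewrite /ok ps' ls' ls eqxx Us' /=.
        by apply/allP => u /(mem_subseq sub); apply: (allP alls).
      by move/smin; rewrite leqNgt ss'.
    have {}js : (j <= size s)%N by [].
    rewrite [nth _ _ 0]/= [nth _ _ _]/=.
    case: j ij js => [|j] _ js; first by rewrite YZ.
    rewrite !eqSS [LHS]/= orFb; have [Ej | ne] := eqVneq j.+1 (size s).
      by rewrite (_ : nth y s j = y') ?YZ // -ls (last_nth y) -Ej.
    have mj : nth y s j \in s by apply: mem_nth.
    apply/negbTE/nZ => //; have := allP alls _ mj; rewrite /= !inE.
    case/or3P=> [/eqP E|/eqP E|//].
      by move: Us; rewrite /= -{1}E mj.
    move/eqP: E; rewrite -ls -nth_last nth_uniq //; first last.
    - by case/andP: Us.
    - by rewrite prednK // ltnW.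
    by rewrite -eqSS prednK ?(negPf ne) // ltnW.
  by move=> ind; case/negP: (chH (z0 :: y :: s) s2).
have [v vZ sv] : exists2 v, v \in Z & {in Z &, forall p q, adj H v p -> adj H v q -> p != q -> adj H p q}.
  apply: IH; last by apply/set0Pn; exists z0.
  apply: leq_trans (_ : #|W| <= n)%N; last by rewrite -ltnS.
  apply: proper_card; apply/properP; split.
    by rewrite /Z; apply: subset_trans (subsetDl _ _) (subsetDl _ _).
  by exists a => //; rewrite inZ aX /= andbF.
have WZ p : p \in W -> adj H v p -> (p \in Z) || (p \in Y).
  move=> pW vp; case pX: (p \in X); first by rewrite (negPf (nZ _ _ vZ pX)) in vp.
  by rewrite /Z !inE pX pW /=; case: [exists _ in _, _].
exists v; first by move: vZ; rewrite !inE => /and3P[].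
move=> p q pW qW vp vq pq.
case/orP: (WZ p pW vp) => hp; case/orP: (WZ q qW vq) => hq.
- exact: sv.
- exact: YZ.
- by rewrite adj_sym; apply: YZ.
- by move/cliqueP: YY; apply.
Qed.

(** Delete simplicial vertices one at a time: the neighbours that a vertex still has when it is
    deleted form a clique, so at most [cap v] edges go with it. *)
Lemma chordal_card_le H (cap : T -> nat) : sgraph H -> chordal H ->
  (forall v S, clique (adj H) S -> (forall u, u \in S -> adj H v u) -> (#|S| <= cap v)%N) ->
  (#|H| <= \sum_v cap v)%N.
Proof.
move=> sH chH hcap.
suff key W : (#|[set E in H | E \subset W]| <= \sum_(v in W) cap v)%N.
  have -> : (\sum_v cap v = \sum_(v in [set: T]) cap v)%N.
    by apply: eq_bigl => v; rewrite inE.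
  apply: leq_trans (key setT); apply: subset_leq_card; apply/subsetP => E EH.
  by rewrite inE EH subsetT.
have [n] := ubnP #|W|; elim: n W => // n IH W Wn.
have [-> | W0] := eqVneq W set0.
  rewrite big_set0 leqn0 cards_eq0 -subset0; apply/subsetP => E.
  rewrite !inE subset0 => /andP[EH /eqP E0]; have /forall_inP/(_ E EH) := sH.
  by rewrite E0 cards0.
have [v vW sv] := chordal_simplicial sH chH W0.
rewrite (big_setD1 v) //=; pose N := nbrs H W v.
have NE : (#|N| <= cap v)%N.
  apply: hcap => [|u]; last by rewrite inE => /andP[].
  by apply/cliqueP => p q; rewrite !inE => /andP[pW vp] /andP[qW vq]; apply: sv.
apply: leq_trans (leq_add NE (IH (W :\ v) _)); last first.
  by move: Wn; rewrite (cardsD1 v) vW.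
apply: leq_trans (leq_add (leq_imset_card (fun u => [set v; u]) N) (leqnn _)).
apply: leq_trans (leq_card_setU _ _); apply: subset_leq_card; apply/subsetP => E.
rewrite !inE => /andP[EH EW]; rewrite EH /= subsetD1 EW /=.
case vE: (v \in E) => /=; rewrite ?orbT // orbF.
have /forall_inP/(_ E EH)/cards2P[x [y [xy Exy]]] := sH.
have [xW yW] : x \in W /\ y \in W.
  by split; apply: (subsetP EW); rewrite Exy !inE eqxx ?orbT.
move: vE; rewrite Exy !inE => /orP[/eqP vx | /eqP vy]; apply/imsetP.
  by exists y; rewrite ?inE ?yW vx // /adj -Exy.
by exists x; rewrite ?inE ?xW vy /adj setUC // -Exy.
Qed.

End Dirac.

(** * The descent *)

Section Degrees.

Variable T : finType.
Implicit Types (G H : {set {set T}}) (A B K S Z : {set T}).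

Lemma exists_subset_card A n : (n <= #|A|)%N -> exists2 B : {set T}, B \subset A & #|B| = n.
Proof.
move=> nA; exists [set x in take n (enum A)].
  by apply/subsetP => x; rewrite inE => /mem_take; rewrite mem_enum.
by rewrite cardsE (card_uniqP _) ?take_uniq ?enum_uniq // size_takel // -cardE.
Qed.

Lemma sum_nbrsC G A K :
  (\sum_(u in A) #|nbrs G K u| = \sum_(v in K) #|nbrs G A v|)%N.
Proof.
have E B u : #|nbrs G B u| = (\sum_(v in B) adj G u v)%N.
  rewrite -sum1_card big_mkcond [RHS]big_mkcond; apply: eq_bigr => v _.
  by rewrite inE; case: (v \in B); case: (adj G u v).
rewrite (eq_bigr _ (fun u _ => E K u)) (eq_bigr _ (fun v _ => E A v)) exchange_big.
by apply: eq_bigr => v _; apply: eq_bigr => u _; rewrite adj_sym.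
Qed.

Lemma card_nbrs_le G K u : (#|nbrs G K u| <= #|K|)%N.
Proof. by apply: subset_leq_card; apply/subsetP => v; rewrite inE => /andP[]. Qed.

Lemma arcs_le (e : rel T) A : (arcs e A <= #|A| * #|A|)%N.
Proof.
rewrite -sum_nat_const; apply: leq_sum => u _.
by apply: subset_leq_card; apply/subsetP => v; rewrite inE => /andP[].
Qed.

Lemma arcs_setD G A B : B \subset A ->
  (arcs (adj G) A <= arcs (adj G) (A :\: B) + 2 * \sum_(u in B) #|nbrs G A u|)%N.
Proof.
move=> BA; rewrite /arcs (big_setID B) /= (setIidPr BA) addnC mulSn mul1n addnA leq_add2r.
have := sum_nbrsC G (A :\: B) B => E.
apply: leq_trans (_ : _ <= \sum_(u in A :\: B) (#|nbrs G (A :\: B) u| + #|nbrs G B u|))%N _.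
  apply: leq_sum => u _; apply: leq_trans (leq_card_setU _ _).
  by apply: subset_leq_card; apply/subsetP => v; rewrite !inE; case: (v \in B) => /andP[-> ->].
rewrite big_split leq_add2l E; apply: leq_sum => v _.
by apply: subset_leq_card; apply/subsetP => w; rewrite !inE => /andP[/andP[_ ->]].
Qed.

(** With the edges inside [Z] removed, a clique has at most one vertex in [Z], as [star_extension]
    demands. *)
Definition thin G Z : rel T := fun x y => adj G x y && ~~ ((x \in Z) && (y \in Z)).

Lemma arcs_thin G Z A :
  (arcs (adj G) A <= arcs (thin G Z) A + #|Z| * #|Z|)%N.
Proof.
rewrite /arcs; apply: leq_trans (_ : _ <= \sum_(u in A)
   (#|[set v in A | thin G Z u v]| + (u \in Z) * #|Z|))%N _.
  apply: leq_sum => u uA; case uZ: (u \in Z); last first.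
    rewrite addn0; apply: subset_leq_card; apply/subsetP => v; rewrite !inE /thin.
    by rewrite uZ andbT.
  rewrite mul1n; apply: leq_trans (leq_card_setU _ _).
  apply: subset_leq_card; apply/subsetP => v; rewrite !inE /thin uZ.
  by case: (v \in Z) => /andP[-> ->].
rewrite big_split leq_add2l -big_distrl leq_mul2r /=; apply/orP; right.
have -> : (\sum_(u in A) (u \in Z) = #|A :&: Z|)%N; last by rewrite subset_leq_card ?subsetIr.
rewrite -sum1_card big_mkcond [RHS]big_mkcond; apply: eq_bigr => u _.
by rewrite inE; do 2 case: (_ \in _).
Qed.

(** All of [A] outside [Z] and [K] is attached to [K]. Summed over [K], the degrees into [A] count
    the edges between [A] and [K]; vertices of [A] in [Z] or in [K] account for at most $k+1$ each,
    which is the loss. *)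
Lemma star_clique G H A Z K (k : nat) :
  H \subset G -> chordal H ->
  (forall u v, u \in A -> u \notin Z -> ~~ adj H u v) ->
  K \in cliques (thin G Z) A k.+1 ->
  exists H', [/\ H' \subset G, chordal H' &
    (#|H| + \sum_(v in K) #|nbrs G A v| <=
       #|H'| + k.+1 * #|A :&: Z| + k.+1 * k.+1)%N].
Proof.
move=> HG chH iso; rewrite inE => /and3P[/subsetP KA /eqP cK /cliqueP clK].
pose S := A :\: (Z :|: K).
have [|||||H' [H'G chH' leH _]] := @star_extension T G H Z K S HG chH.
- by apply/cliqueP => u v uK vK uv; have /andP[] := clK u v uK vK uv.
- move=> u v uK vK uZ vZ; apply/eqP/negPn/negP => uv.
  by have /andP[_] := clK u v uK vK uv; rewrite uZ vZ.
- by rewrite disjoint_sym disjoints_subset; apply/subsetP => u uK; rewrite !inE uK orbT.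
- by rewrite disjoint_sym disjoints_subset; apply/subsetP => u uK; rewrite !inE uK.
- by move=> u v; rewrite !inE => /orP[/KA|/andP[_]]; apply: iso.
exists H'; split=> //; rewrite -sum_nbrsC -cK.
rewrite (big_setID (Z :|: K)) /= -/S.
have le2 : (\sum_(u in A :&: (Z :|: K)) #|nbrs G K u| <= #|K| * #|A :&: Z| + #|K| * #|K|)%N.
  rewrite -mulnDr mulnC; apply: leq_trans (_ : _ <= #|A :&: (Z :|: K)| * #|K|)%N _.
    by rewrite -sum_nat_const; apply: leq_sum => u _; apply: card_nbrs_le.
  rewrite leq_mul2r setIUr; apply/orP; right; apply: leq_trans (leq_card_setU _ _) _.
  by rewrite leq_add2l subset_leq_card ?subsetIr.
move: le2 leH; set a := (\sum_(u in _) _)%N; set b := (\sum_(u in S) _)%N.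
move: (#|K| * _)%N (#|K| * _)%N => p q le2 leH.
by rewrite addnCA (leq_trans (leq_add le2 leH)) // addnC addnA.
Qed.

End Degrees.

(* A new star costs [piece_cost]: its [k] centres are charged [center_cost] each and
   may lose their own [k + 1] edges.  Degrees may fall short of the ideal value by
   [slack * r], where [r] stands for the square root of [n]. *)
Section Constants.

Variables (R : realFieldType) (k : nat).
Local Notation K := (k%:R : R).

Definition center_cost : R := 4 * (K * (K + 1) + 1).
Definition piece_cost : R := K * (K + 1 + center_cost).
Definition slack : R := 8 * piece_cost + 8.
Definition excess_min : R := slack + 16.
(** Large enough for both ways in which the descent ends: at a clique of large degrees
    ([loss_ge_star]) and at an arbitrary clique ([loss_ge_small]). *)
Definition loss : R :=
  (K * (K + 1) + 1) * (excess_min + slack) + (K + 1) * slack + (K + 1) ^+ 2.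

Lemma center_cost_ge0 : 0 <= center_cost.
Proof. by rewrite /center_cost; have := ler0n R k; nra. Qed.

Lemma piece_cost_ge (k0 : (0 < k)%N) : 6 * K ^+ 2 <= piece_cost /\ 14 * K <= piece_cost.
Proof.
have K1 : 1 <= K by rewrite ler1n.
by rewrite /piece_cost /center_cost expr2; split; nra.
Qed.

Lemma loss_ge_star (k0 : (0 < k)%N) : (K + 1) * slack + (K + 1) ^+ 2 <= loss.
Proof.
have [g1 g2] := piece_cost_ge k0; have K1 : 1 <= K by rewrite ler1n.
rewrite /loss -addrA lerDr mulr_ge0 //; first by nra.
by rewrite /excess_min /slack; lra.
Qed.

Lemma loss_ge_small (k0 : (0 < k)%N) :
  (K * (K + 1) + 1) * (excess_min + slack) + (K + 1) ^+ 2 <= loss.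
Proof.
have [g1 g2] := piece_cost_ge k0; have K1 : 1 <= K by rewrite ler1n.
rewrite /loss lerD2r lerDl mulr_ge0 //; first by lra.
by rewrite /slack; lra.
Qed.

End Constants.

(** * Inequalities for the descent *)

Section Arithmetic.

Variable R : realFieldType.
Implicit Types K i x t r g c : R.

(** Here and below, [i] stands for $1/K$, [t] for the number of vertices of [A], [D] for its arcs
    and [x] for its excess. Since $D\le t^2$, the surplus is at most $t^2/K$, whence $x^2\le
    2t^2$. *)
Lemma excess_le K i x t D : 1 <= K -> K * i = 1 -> 0 < i -> 0 <= x -> 0 <= t -> D <= t ^+ 2 ->
  K * x ^+ 2 <= (K + 1) * (D - (1 - i) * t ^+ 2) -> x <= 2 * t.
Proof.
move=> K1 Ki i0 x0 t0 Dt hx.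
have i1 : i <= 1 by nra.
have h : (K + 1) * (D - (1 - i) * t ^+ 2) <= (K + 1) * (i * t ^+ 2).
  by rewrite ler_wpM2l; lra.
have h2 : (K + 1) * (i * t ^+ 2) = (1 + i) * t ^+ 2.
  by have -> : (K + 1) * (i * t ^+ 2) = (K * i + i) * t ^+ 2 by [ring]; rewrite Ki.
have h3 : (1 + i) * t ^+ 2 <= 2 * t ^+ 2 by rewrite ler_wpM2r ?sqr_ge0 //; lra.
have h4 : x ^+ 2 <= K * x ^+ 2 by rewrite ler_peMl ?sqr_ge0.
have h5 : x ^+ 2 <= 2 * t ^+ 2 by rewrite -h2 in h3; lra.
by rewrite leNgt; apply/negP => lt; clear - lt h5 t0; nra.
Qed.

(** Discarding a vertex of very small degree [d] raises the excess by [K], more than the $K-1/K$ by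
    which the main term drops; such a vertex need never be attached. *)
Lemma excess_drop K i x t d D D' : 1 <= K -> K * i = 1 -> 0 < i -> 8 * K ^+ 2 + 16 <= x ->
  D <= D' + 2 * d -> d <= (1 - i) * (1 + t) - K * x ->
  K * x ^+ 2 <= (K + 1) * (D - (1 - i) * (1 + t) ^+ 2) ->
  K * (x + K) ^+ 2 <= (K + 1) * (D' - (1 - i) * t ^+ 2).
Proof.
move=> K1 Ki i0 x_ge hD hd hx.
have -> : (K + 1) * (D' - (1 - i) * t ^+ 2) = (K + 1) * (D - (1 - i) * (1 + t) ^+ 2) +
    (K + 1) * (2 * ((1 - i) * (1 + t) - K * x - d) + (D' + 2 * d - D)) +
    (K + 1) * (2 * K * x - (1 - i)) by ring.
have h1 : 0 <= (K + 1) * (2 * ((1 - i) * (1 + t) - K * x - d) + (D' + 2 * d - D)).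
  by apply: mulr_ge0; lra.
have h2 : K * (2 * K * x + K ^+ 2) <= (K + 1) * (2 * K * x - (1 - i)).
  have a1 : K * (8 * K ^+ 2 + 16) <= K * x by rewrite ler_wpM2l //; lra.
  by clear - a1 K1 Ki i0; rewrite expr2 in a1 *; nra.
have -> : K * (x + K) ^+ 2 = K * x ^+ 2 + K * (2 * K * x + K ^+ 2) by ring.
by clear - h1 h2 hx; lra.
Qed.

(** The surplus is at least $x^2/2$, and the arcs inside [Z] number at most $z^2\le x^2/4$; the
    other half is left for [moon_moser]. *)
Lemma thin_excess K i x t z D D' : 1 <= K -> 0 < t -> 0 <= z -> z <= x / 2 ->
  D <= D' + z * z -> K * x ^+ 2 <= (K + 1) * (D - (1 - i) * t ^+ 2) ->
  ((1 - i) * t + x ^+ 2 / (4 * t)) * t <= D'.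
Proof.
move=> K1 t0 z0 zx hD hx.
have z2 : z * z <= x ^+ 2 / 4 by rewrite expr2; nra.
have -> : ((1 - i) * t + x ^+ 2 / (4 * t)) * t = (1 - i) * t ^+ 2 + x ^+ 2 / 4.
  by field; rewrite gt_eqF.
have : x ^+ 2 / 2 <= D - (1 - i) * t ^+ 2; last by lra.
have h : (K + 1) * (x ^+ 2 / 2) <= (K + 1) * (D - (1 - i) * t ^+ 2).
  apply: le_trans hx; have : 0 <= (K - 1) * x ^+ 2 by rewrite mulr_ge0 ?sqr_ge0 //; lra.
  by lra.
by move: h; rewrite ler_pM2l //; lra.
Qed.

(** With only the weak degree bound, a star falls short by $(K(K+1)+1)x$. The charge $Mz$ covers
    this when $x\le 4z$, which dictates the value of [M], and $Cr$ covers it when $x\le cr$. *)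
Lemma small_star_bound K i t x z h b M c C r :
  K * i = 1 -> 1 <= K -> 1 <= r -> 0 <= z -> 0 <= c -> M = 4 * (K * (K + 1) + 1) ->
  (K * (K + 1) + 1) * c + (K + 1) ^+ 2 <= C ->
  (x <= 4 * z) || (x <= c * r) ->
  (K - i) * t + x + h - (K + 1) * b - M * z - C * r <=
    h + (K + 1) * ((1 - i) * t - K * x) - (K + 1) * b - (K + 1) ^+ 2.
Proof.
move=> Ki K1 r1 z0 c0 ME hC small.
have -> : (K + 1) * ((1 - i) * t - K * x) = (K - i) * t - K * (K + 1) * x + (1 - K * i) * t by ring.
rewrite Ki subrr mul0r addr0.
have P0 : 0 <= K * (K + 1) + 1 by nra.
have Cr : ((K * (K + 1) + 1) * c + (K + 1) ^+ 2) * r <= C * r by rewrite ler_wpM2r //; lra.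
have Pr : (K + 1) ^+ 2 <= (K + 1) ^+ 2 * r by rewrite ler_peMr ?sqr_ge0.
have Pz : 0 <= (K * (K + 1) + 1) * z by rewrite mulr_ge0.
have Pc : 0 <= (K * (K + 1) + 1) * c * r by rewrite mulr_ge0 ?mulr_ge0 //; lra.
suff : (K * (K + 1) + 1) * x <= M * z + C * r - (K + 1) ^+ 2.
  by move=> hs; clear - hs; lra.
rewrite ME; case/orP: small => hx.
  have : (K * (K + 1) + 1) * x <= (K * (K + 1) + 1) * (4 * z) by rewrite ler_wpM2l.
  by move=> hs; clear - hs Cr Pr Pc; lra.
have : (K * (K + 1) + 1) * x <= (K * (K + 1) + 1) * (c * r) by rewrite ler_wpM2l.
by move=> hs; clear - hs Cr Pr Pz; lra.
Qed.

(** Since $(K+1)(1-1/K)=K-1/K$, degrees at the threshold add up to the desired main term plus [x],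
    up to the slack. *)
Lemma star_bound K i t x z h b M c C r :
  K * i = 1 -> 1 <= K -> 1 <= r -> 0 <= z -> 0 <= M ->
  (K + 1) * c + (K + 1) ^+ 2 <= C ->
  (K - i) * t + x + h - (K + 1) * b - M * z - C * r <=
    h + (K + 1) * ((1 - i) * t + x / (K + 1) - c * r) - (K + 1) * b - (K + 1) ^+ 2.
Proof.
move=> Ki K1 r1 z0 M0 hC.
have -> : (K + 1) * ((1 - i) * t + x / (K + 1) - c * r) =
    (K - i) * t + x - (K + 1) * c * r + (1 - K * i) * t.
  by field; rewrite gt_eqF //; lra.
rewrite Ki subrr mul0r addr0.
have Cr : ((K + 1) * c + (K + 1) ^+ 2) * r <= C * r by rewrite ler_wpM2r //; lra.
have Pr : (K + 1) ^+ 2 <= (K + 1) ^+ 2 * r by rewrite ler_peMr ?sqr_ge0.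
have Mz : 0 <= M * z by rewrite mulr_ge0.
by clear - Cr Pr Mz; lra.
Qed.

(** Removing [l] vertices of degree at most the ideal value would cost $l/K$ of excess. The slack
    $cr$ in each degree saves $l\,cr\ge 2gx$ in total, enough to raise the excess by [g] as well. *)
Lemma excess_piece K i x t g c r l D D' S :
  1 <= K -> K * i = 1 -> 0 < i -> 0 <= g -> 0 <= l -> 0 <= c * r -> g <= x ->
  2 * g * x <= l * (c * r) -> l <= c * r / 4 ->
  D <= D' + 2 * S -> S <= l * ((1 - i) * t + x / (K + 1) - c * r) ->
  K * x ^+ 2 <= (K + 1) * (D - (1 - i) * t ^+ 2) ->
  K * (x - l * i + g) ^+ 2 <= (K + 1) * (D' - (1 - i) * (t - l) ^+ 2).
Proof.
set X := _ - c * r => K1 Ki i0 g0 l0 cr0 gx lcr l_cr hD hS hx.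
have KX : (K + 1) * X = (K - i) * t + x - (K + 1) * (c * r) + (1 - K * i) * t.
  by rewrite /X; field; rewrite gt_eqF //; lra.
rewrite Ki subrr mul0r addr0 in KX.
have id1 : (K + 1) * (D' - (1 - i) * (t - l) ^+ 2) = (K + 1) * (D - (1 - i) * t ^+ 2) +
    (K + 1) * ((D' + 2 * S - D) + 2 * (l * X - S)) +
    (2 * l * ((K + 1) * (1 - i) * t - (K + 1) * X) - (K + 1) * (1 - i) * l ^+ 2) by ring.
have Ki1 : (K + 1) * (1 - i) = K - i.
  by have -> : (K + 1) * (1 - i) = K - i + (1 - K * i) by [ring]; rewrite Ki subrr addr0.
have id2 : K * (x - l * i + g) ^+ 2 = K * x ^+ 2 - 2 * x * l * (K * i) +
    l ^+ 2 * i * (K * i) + K * g ^+ 2 + 2 * K * x * g - 2 * l * g * (K * i) by ring.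
have h1 : 0 <= (K + 1) * ((D' + 2 * S - D) + 2 * (l * X - S)).
  by apply: mulr_ge0; clear - K1 hD hS; lra.
rewrite id1 id2 KX Ki1 Ki; set P := l * (c * r) in lcr.
have -> : 2 * l * ((K - i) * t - ((K - i) * t + x - (K + 1) * (c * r))) =
   2 * (K + 1) * P - 2 * x * l by rewrite /P; ring.
have l2 : l ^+ 2 <= P / 4 by rewrite expr2 /P -mulrA ler_wpM2l.
have P0 : 0 <= P by rewrite /P mulr_ge0.
have K0 : 0 <= K by lra.
have a1 : K * l ^+ 2 <= K * (P / 4) by rewrite ler_wpM2l.
have a2 : K * (2 * g * x) <= K * P by rewrite ler_wpM2l.
have a3 : K * (g * g) <= K * (g * x) by rewrite !ler_wpM2l.
have a4 : 0 <= l * g by rewrite mulr_ge0.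
have a5 : 0 <= K * P by rewrite mulr_ge0.
rewrite [g ^+ 2]expr2 !mulr1; clear - a1 a2 a3 a4 a5 h1 hx P0; lra.
Qed.

(** Of the [l] removed vertices, [s] bring [K] edges each and [b] are old centres, whose charge of
    $K+1$ is refunded on leaving [A]. The gain [g] pays the charges $K+1+M$ of up to [K] new
    centres. *)
Lemma piece_bound K i x t' g l M C h h' a a' b s z z' :
  0 <= K -> 0 <= M -> 0 <= b -> g = K * (K + 1 + M) ->
  l = b + s -> a' + b <= a + K -> h + s * K <= h' -> z' <= z + K ->
  (K - i) * (l + t') + x + h - (K + 1) * a - M * z - C <=
    (K - i) * t' + (x - l * i + g) + h' - (K + 1) * a' - M * z' - C.
Proof.
move=> K0 M0 b0 -> -> haz hh hz.
have b1 : (K + 1) * (a' + b) <= (K + 1) * (a + K) by rewrite ler_wpM2l //; lra.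
have b2 : M * z' <= M * (z + K) by rewrite ler_wpM2l.
by clear - b0 b1 b2 hh; lra.
Qed.

End Arithmetic.

Lemma nat_above (R : realType) (y : R) : 0 <= y ->
  exists n : nat, y <= n%:R /\ n%:R <= y + 1.
Proof.
move=> y0; exists (Num.trunc y).+1; split; first exact/ltW/truncnS_gt.
by rewrite -natr1 lerD2r truncn_le.
Qed.

(** A suitable [l] is $2gx/(cr)$ rounded up: enough leaves to pay for a star, yet no more than the
    common neighbours that [exists_clique_joint] supplies for $be=x^2/(4t)$. *)
Lemma piece_size (R : realType) (g c r x t : R) : 14 <= g -> c = 8 * g + 8 ->
  1 <= r -> r * 16 <= x -> 0 < t -> x <= 2 * t -> t <= r ^+ 2 ->
  exists l : nat, [/\ 2 * g * x <= l%:R * (c * r), l%:R <= c * r / 4 &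
    l%:R <= x ^+ 2 / (4 * t) / 2].
Proof.
move=> g0 cE r1 rx t0 xt tr.
have r0 : 0 < r by lra.
have cr0 : 0 < c * r by rewrite mulr_gt0 //; lra.
have [|l [l_ge l_le]] := @nat_above R (2 * g * x / (c * r)).
  by rewrite divr_ge0 ?(ltW cr0) // !mulr_ge0 //; lra.
exists l; split.
- by rewrite -ler_pdivrMr.
- have : 2 * g * x / (c * r) <= r / 2.
    rewrite ler_pdivrMr //.
    have e1 : g * x <= g * (2 * r ^+ 2) by rewrite ler_wpM2l //; lra.
    have e2 : 8 * g * r ^+ 2 <= c * r ^+ 2 by rewrite ler_wpM2r ?sqr_ge0 //; lra.
    have -> : r / 2 * (c * r) = c * r ^+ 2 / 2 by field.
    by clear - e1 e2; lra.
  have : 14 * r <= c * r by rewrite ler_wpM2r //; lra.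
  by clear - l_le r1; lra.
- have [w xw] : exists w, x = w * r by exists (x / r); rewrite divfK // gt_eqF.
  have w16 : 16 <= w by rewrite xw mulrC ler_pM2r in rx.
  have : 2 * g * x / (c * r) <= w / 4.
    rewrite ler_pdivrMr //.
    have -> : w / 4 * (c * r) = w * r * (c / 4) by field.
    have : x * (2 * g) <= x * (c / 4) by rewrite ler_wpM2l //; lra.
    by rewrite -xw => h; clear - h; lra.
  have : w ^+ 2 / 8 <= x ^+ 2 / (4 * t) / 2.
    have -> : x ^+ 2 / (4 * t) / 2 = x ^+ 2 / (8 * t) by field; rewrite gt_eqF.
    rewrite ler_pdivlMr; last lra.
    have : w ^+ 2 * t <= w ^+ 2 * r ^+ 2 by rewrite ler_wpM2l // sqr_ge0.
    by rewrite xw exprMn => h; clear - h; lra.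
  have : 16 * w <= w ^+ 2 by rewrite expr2 ler_wpM2r //; lra.
  by clear - l_le w16; lra.
Qed.

Lemma thin_irr (T : finType) (G : {set {set T}}) Z : sgraph G -> irreflexive (thin G Z).
Proof. by move=> sG x; rewrite /thin adj_irr. Qed.

Lemma thin_sym (T : finType) (G : {set {set T}}) Z : symmetric (thin G Z).
Proof. by move=> x y; rewrite /thin adj_sym [(y \in Z) && _]andbC. Qed.

Lemma star_clique_real (R : realFieldType) (T : finType) (G H : {set {set T}})
    (A Z Q : {set T}) (k : nat) (X : R) :
  H \subset G -> chordal H ->
  (forall u v, u \in A -> u \notin Z -> ~~ adj H u v) ->
  Q \in cliques (thin G Z) A k.+1 ->
  (forall v, v \in Q -> X <= #|nbrs G A v|%:R) ->
  exists H' : {set {set T}}, [/\ H' \subset G, chordal H' &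
    #|H|%:R + (k%:R + 1) * X - (k%:R + 1) * #|A :&: Z|%:R - (k%:R + 1) ^+ 2 <= #|H'|%:R].
Proof.
move=> HG chH iso hQ hX; have [H' [H'G chH' leH']] := star_clique HG chH iso hQ.
exists H'; split=> //; move: leH'; rewrite -(ler_nat R) !natrD !natrM natr_sum.
have : \sum_(v in Q) X <= \sum_(v in Q) #|nbrs G A v|%:R by apply: ler_sum.
move: (hQ); rewrite sumr_const inE => /and3P[_ /eqP-> _].
by rewrite -mulr_natl -natr1 expr2 => h1 h2; clear - h1 h2; lra.
Qed.

(* [A] is the set of vertices that are not yet attached; [H] is a union of stars
   joined to [k]-cliques, whose vertices, the centres, form [Z]; [x] is the excess
   of [A].  The left-hand side of the conclusion is a potential, and no step of the
   descent on [#|A|] lets it decrease.  A new clique may share one vertex with [Z];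
   [thin G Z] excludes those sharing more. *)
Lemma chordal_descent (R : realType) (T : finType) (G : {set {set T}}) (k : nat) (r : R)
    (A Z : {set T}) (H : {set {set T}}) (x : R) :
  sgraph G -> (0 < k)%N -> 1 <= r -> #|T|%:R <= r ^+ 2 ->
  H \subset G -> chordal H ->
  (forall u v, u \in A -> u \notin Z -> ~~ adj H u v) ->
  excess_min R k * r <= x -> #|Z|%:R <= x / 2 ->
  k%:R * x ^+ 2 <=
    (k%:R + 1) * ((arcs (adj G) A)%:R - (1 - 1 / k%:R) * #|A|%:R ^+ 2) ->
  exists H' : {set {set T}}, [/\ H' \subset G, chordal H' &
    (k%:R - 1 / k%:R) * #|A|%:R + x + #|H|%:R - (k%:R + 1) * #|A :&: Z|%:R
      - center_cost R k * #|Z|%:R - loss R k * r <= #|H'|%:R].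
Proof.
move=> sG k_gt0 r1 hr.
have K1 : 1 <= k%:R :> R by rewrite ler1n.
have lossS := loss_ge_small R k_gt0; have lossB := loss_ge_star R k_gt0.
have [gK2 gK] := piece_cost_ge R k_gt0; have M0 := center_cost_ge0 R k.
have gE : piece_cost R k = k%:R * (k%:R + 1 + center_cost R k) by [].
have cE : slack R k = 8 * piece_cost R k + 8 by [].
have mE : excess_min R k = slack R k + 16 by [].
have ME : center_cost R k = 4 * (k%:R * (k%:R + 1) + 1) by [].
move: lossS lossB gK2 gK M0 gE cE mE ME.
move: (center_cost R k) (piece_cost R k) (slack R k) (excess_min R k) (loss R k) => M g c c0 C.
have [i iE] : exists i, i = 1 / k%:R :> R by exists (1 / k%:R).
rewrite -iE; move: K1; have [K KE] : exists K, K = k%:R :> R by exists k%:R.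
rewrite -KE => K1 lossS lossB gK2 gK M0 gE cE mE ME.
have K0 : 0 < K by lra.
have Ki : K * i = 1 by rewrite iE -KE mulrC divfK // gt_eqF.
have i0 : 0 < i by rewrite iE -KE divr_gt0.
have g14 : 14 <= g by clear - gK K1; lra.
have gpos : 0 <= g by lra.
have r0 : 0 < r by lra.
have cr0 : 0 <= c * r by rewrite mulr_ge0 ?(ltW r0) // cE; lra.
have c0_ge : 8 * K ^+ 2 + 16 <= c0 by clear - mE cE gK2 g14; have := sqr_ge0 K; lra.
have c16 : 16 <= c0 by clear - mE cE g14; lra.
have [n] := ubnP #|A|; elim: n A Z H x => // n IH A Z H x An HG chH iso xmin Zx hx.
have c0x : c0 <= x by apply: le_trans xmin; rewrite ler_peMr //; lra.
have rx : r * 16 <= x by apply: le_trans xmin; rewrite mulrC ler_pM2r.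
have x0 : 0 < x by clear - c0x c16; lra.
have t0 : 0 <= #|A|%:R :> R by rewrite ler0n.
have tr : #|A|%:R <= r ^+ 2 by apply: le_trans hr; rewrite ler_nat max_card.
have Dt : (arcs (adj G) A)%:R <= #|A|%:R ^+ 2 :> R.
  by rewrite -natrX ler_nat expnS expn1 arcs_le.
have x2t := excess_le K1 Ki i0 (ltW x0) t0 Dt hx.
have tgt0 : 0 < #|A|%:R :> R by clear - x2t x0; lra.
have x_ge : 8 * K ^+ 2 + 16 <= x by apply: le_trans c0x.
have z0 : 0 <= #|Z|%:R :> R by rewrite ler0n.
(* First discard, without attaching them, vertices of very small degree, until every $(k+1)$-clique
   has a usable degree bound. *)
have [/exists_inP[u uA ulow] | /exists_inPn nolow] :=
    boolP [exists u in A, #|nbrs G A u|%:R < (1 - i) * #|A|%:R - K * x].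
  have cA : #|A|%:R = 1 + #|A :\ u|%:R :> R by rewrite (cardsD1 u) uA natrD.
  have := @arcs_setD T G A [set u]; rewrite sub1set big_set1 => /(_ uA).
  rewrite -(ler_nat R) natrD natrM => hD.
  rewrite cA in hx ulow *.
  have [|||||H' [H'G chH' leH']] := IH (A :\ u) Z H (x + K) _ HG chH.
  - by move: An; rewrite (cardsD1 u) uA.
  - by move=> v w; rewrite inE => /andP[_]; apply: iso.
  - by clear - xmin K0; lra.
  - by clear - Zx K0; lra.
  - exact: excess_drop K1 Ki i0 x_ge hD (ltW ulow) hx.
  exists H'; split=> //; apply: le_trans leH'.
  have : #|(A :\ u) :&: Z|%:R <= #|A :&: Z|%:R :> R.
    by rewrite ler_nat subset_leq_card // setSI // subD1set.
  set a := #|(A :\ u) :&: Z|%:R; set b := #|A :&: Z|%:R => ab.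
  have : (K + 1) * a <= (K + 1) * b by rewrite ler_wpM2l //; clear - K0; lra.
  by clear - i0; lra.
have deg v : v \in A -> (1 - i) * #|A|%:R - K * x <= #|nbrs G A v|%:R.
  by move=> vA; have := nolow v vA; rewrite -leNgt.
have A0 : (0 < #|A|)%N by rewrite -(ltr0n R).
pose be : R := x ^+ 2 / (4 * #|A|%:R).
have be0 : 0 < be by rewrite divr_gt0 ?exprn_gt0 // mulr_gt0.
have hthin : ((1 - 1 / k%:R) * #|A|%:R + be) * #|A|%:R <= (arcs (thin G Z) A)%:R.
  have := arcs_thin G Z A; rewrite -(ler_nat R) natrD natrM => hD.
  by rewrite -iE; apply: thin_excess K1 tgt0 z0 Zx hD hx.
have final (Q : {set T}) (X : R) := @star_clique_real R T G H A Z Q k X HG chH iso.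
have QA j (Q : {set T}) v : Q \in cliques (thin G Z) A j -> v \in Q -> v \in A.
  by rewrite inE => /and3P[/subsetP QA _ _]; apply: QA.
have tI := @thin_irr T G Z sG; have tS := @thin_sym T G Z.
(* If [Z] is large, its charge in the potential exceeds what is lost by attaching [A]
   to an arbitrary [k.+1]-clique. *)
have [small | ] := boolP ((x <= 4 * #|Z|%:R) || (x <= (c0 + c) * r)).
  have [Nk hk] := moon_moser tI tS k_gt0 be0 A0 hthin.
  have /card_gt0P[Q hQ] : (0 < #|cliques (thin G Z) A k.+1|)%N.
    rewrite -(ltr0n R) -(pmulr_rgt0 _ (ltr0Sn R k)); apply: lt_le_trans hk.
    by rewrite mulr_gt0 ?ltr0n // mulr_gt0 // -KE.
  have [H' [H'G chH' leH']] := final Q _ hQ (fun v vQ => deg v (QA _ _ _ hQ vQ)).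
  exists H'; split=> //; apply: le_trans leH'; rewrite -KE.
  apply: small_star_bound Ki K1 r1 z0 _ ME lossS small.
  by clear - mE cE g14; lra.
rewrite negb_or -!ltNge => /andP[zx xr].
(* The ideal degree of a centre, lowered by the slack; [B] collects the vertices below it. A
   $(k+1)$-clique avoiding [B] ends the descent. *)
pose X : R := (1 - i) * #|A|%:R + x / (K + 1) - c * r.
pose B := [set v in A | #|nbrs G A v|%:R < X].
have [/exists_inP[Q hQ disQB] | /exists_inPn noQ] :=
    boolP [exists Q in cliques (thin G Z) A k.+1, [disjoint Q & B]].
  have QX v : v \in Q -> X <= #|nbrs G A v|%:R.
    move=> vQ; rewrite leNgt; move: (disjointFr disQB vQ).
    by rewrite inE (QA _ _ _ hQ vQ) /= => ->.
  have [H' [H'G chH' leH']] := final Q X hQ QX.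
  exists H'; split=> //; apply: le_trans leH'; rewrite -KE.
  exact: star_bound Ki K1 r1 z0 M0 lossB.
have [Q hQ beQ] := exists_clique_joint tI tS k_gt0 be0 A0 hthin noQ.
have [l [lcr l_cr l_be]] := piece_size g14 cE r1 rx tgt0 x2t tr.
have /exists_subset_card[B' /subsetP sB' cB'] : (l <= #|joint (thin G Z) A Q :&: B|)%N.
  by rewrite -(ler_nat R); apply: le_trans l_be beQ.
have cQ : #|Q| = k by move: hQ; rewrite inE => /and3P[_ /eqP].
have clQ : {in Q &, forall u v, u != v -> thin G Z u v}.
  by move: hQ; rewrite inE => /and3P[_ _ /cliqueP].
have B'A v : v \in B' -> v \in A by move=> /sB'; rewrite !inE => /andP[_ /andP[]].
have B'X v : v \in B' -> #|nbrs G A v|%:R <= X.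
  by move=> /sB'; rewrite !inE => /andP[_ /andP[_ /ltW]].
have B'Q v : v \in B' -> v \notin Q.
  by move=> /sB'; rewrite inE => /andP[/(joint_notin tI)].
have B'adj v q : v \in B' -> q \in Q -> adj G v q.
  by move=> /sB'; rewrite inE => /andP[/jointP[_ h] _] /h /andP[].
(* Members of [B'] in [Z] get no new edges to [Q] as leaves, but they still leave [A]. *)
have [|||||H' [H'G chH' leH' isoH']] := @star_extension T G H Z Q (B' :\: Z) HG chH.
- by apply/cliqueP => u v uQ vQ uv; have /andP[] := clQ u v uQ vQ uv.
- move=> u v uQ vQ uZ vZ; apply/eqP/negPn/negP => uv.
  by have /andP[_] := clQ u v uQ vQ uv; rewrite uZ vZ.
- rewrite disjoints_subset; apply/subsetP => v; rewrite !inE => /andP[_ vB].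
  exact: B'Q.
- by rewrite disjoints_subset; apply/subsetP => v; rewrite !inE => /andP[].
- by move=> u v; rewrite !inE => /orP[/(QA _ _ _ hQ)|/andP[_ /B'A]]; apply: iso.
have B'sub : B' \subset A by apply/subsetP.
have cA : #|A|%:R = l%:R + #|A :\: B'|%:R :> R.
  by rewrite -natrD -cB' -(cardsID B' A) (setIidPr B'sub).
have l0 : 0 <= l%:R :> R by rewrite ler0n.
have l_gt0 : (0 < l)%N.
  rewrite lt0n; apply/eqP => lE; move: lcr; rewrite lE mul0r leNgt => /negP; apply.
  by rewrite !mulr_gt0 //; clear - g14; lra.
have cZQ : #|Z :|: Q|%:R <= #|Z|%:R + K.
  by rewrite KE -natrD ler_nat -cQ leq_card_setU.
have li0 : 0 <= l%:R * i by rewrite mulr_ge0 // ltW.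
have li : l%:R * i <= c * r / 4.
  apply: le_trans l_cr; rewrite ler_piMr //.
  by rewrite -Ki ler_peMl // ltW.
have c0r : 16 <= c0 * r by apply: (le_trans c16); rewrite ler_peMr //; clear - c16; lra.
have cr_c : c <= c * r by rewrite ler_peMr // cE; clear - g14; lra.
rewrite mulrDl in xr.
(* Because $x>(c_0+c)r$ and $x>4|Z|$, the smaller excess and the larger set of centres still satisfy
   the invariants. *)
have [|||||H'' [H''G chH'' leH'']] :=
  IH (A :\: B') (Z :|: Q) H' (x - l%:R * i + g) _ H'G chH'.
- move: An; rewrite -(cardsID B' A) (setIidPr B'sub) cB' ltnS; apply: leq_trans.
  by rewrite -[X in (X < _)%N]add0n ltn_add2r.
- move=> u v; rewrite !inE => /andP[uB' uA] /norP[uZ uQ]; apply: isoH'.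
    by rewrite !inE (negPf uQ) (negPf uB') andbF.
  by move=> w; apply: iso.
- by clear - xr li gpos cr0; lra.
- by clear - cZQ zx xr li gK K1 cr0 c0r; lra.
- have hD := arcs_setD G B'sub; move: hD; rewrite -(ler_nat R) natrD natrM natr_sum => hD.
  have hS : \sum_(u in B') #|nbrs G A u|%:R <= l%:R * X.
    by rewrite -cB' mulr_natl -sumr_const; apply: ler_sum => v; exact: B'X.
  have -> : #|A :\: B'|%:R = #|A|%:R - l%:R :> R by rewrite cA addrC addKr.
  have gx : g <= x by clear - cE cr_c c0r xr cr0 gpos; lra.
  exact: excess_piece K1 Ki i0 gpos l0 cr0 gx lcr l_cr hD hS hx.
exists H''; split=> //; apply: le_trans leH''; rewrite cA.
have sumQ : (\sum_(s in B' :\: Z) #|nbrs G Q s| = #|B' :\: Z| * k)%N.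
  rewrite -sum_nat_const; apply: eq_bigr => s; rewrite inE => /andP[_ sB].
  rewrite -cQ; congr (#|pred_of_set _|); apply/setP => q; rewrite inE andb_idr //.
  exact: B'adj.
have cBZ : l%:R = #|B' :&: Z|%:R + #|B' :\: Z|%:R :> R by rewrite -natrD cardsID cB'.
have hAZ : #|(A :\: B') :&: (Z :|: Q)|%:R + #|B' :&: Z|%:R <= #|A :&: Z|%:R + K.
  rewrite KE -!natrD ler_nat -cQ -(cardsID B' (A :&: Z)) addnC -addnA leq_add //.
    by apply: subset_leq_card; apply/subsetP => v; rewrite !inE => /andP[vB ->]; rewrite vB B'A.
  apply: leq_trans (leq_card_setU _ _); apply: subset_leq_card; apply/subsetP => v.
  by rewrite !inE => /andP[/andP[-> ->]].
apply: piece_bound (ltW K0) M0 (ler0n _ _) gE cBZ hAZ _ cZQ.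
by move: leH'; rewrite sumQ -(ler_nat R) natrD natrM KE.
Qed.

(** * Turan graphs and the lower bound *)

Section Turan.

Lemma count_modn (k n s : nat) : (s < k)%N ->
  (\sum_(v < n) (v %% k == s) = (n + k.-1 - s) %/ k)%N.
Proof.
move=> sk; have k0 : (0 < k)%N by lia.
elim: n => [|n IH]; first by rewrite big_ord0 divn_small //; lia.
rewrite big_ord_recr /= IH.
have -> : (n.+1 + k.-1 - s = (n + k.-1 - s).+1)%N by lia.
rewrite divnS // addnC; congr (_ + _)%N; congr (nat_of_bool _).
have -> : ((n + k.-1 - s).+1 = n + k - s)%N by lia.
rewrite -eqn_mod_dvd; last lia.
by rewrite modnDr (modn_small sk).
Qed.

Lemma turan_graphE (k n : nat) :
  turan_graph k n = edges (fun u v : 'I_n => u %% k != v %% k)%N.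
Proof. by []. Qed.

Lemma sgraph_turan (k n : nat) : sgraph (turan_graph k n).
Proof. by rewrite turan_graphE sgraph_edges // => u; rewrite eqxx. Qed.

Lemma turan_size_sum (k n : nat) :
  (2 * turan_size k n = \sum_(u < n) \sum_(v < n) (u %% k != v %% k))%N.
Proof.
apply/eqP; rewrite -(eqr_nat int) natrM /turan_size handshake ?sgraph_turan // eqr_nat.
apply/eqP; rewrite /arcs big_mkcond; apply: eq_bigr => u _; rewrite inE.
rewrite -sum1_card big_mkcond; apply: eq_bigr => v _.
by rewrite !inE turan_graphE adj_edges eq_sym orbb; case: eqP.
Qed.

(** The last vertex [n] misses exactly the [n %/ k] earlier vertices of its residue class. *)
Lemma turan_sizeS (k n : nat) : (0 < k)%N ->
  turan_size k n.+1 = (turan_size k n + (n - n %/ k))%N.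
Proof.
move=> k0; apply/eqP; rewrite -(eqn_pmul2l (isT : 0 < 2)%N) mulnDr !turan_size_sum.
rewrite big_ord_recr /= (eq_bigr (fun u : 'I_n =>
  \sum_(v < n) (u %% k != v %% k) + (u %% k != n %% k)))%N; last first.
  by move=> u _; rewrite big_ord_recr.
rewrite big_split big_ord_recr /= eqxx addn0 -addnA eqn_add2l.
have -> : (\sum_(i < n) (n %% k != i %% k) = \sum_(i < n) (i %% k != n %% k))%N.
  by apply: eq_bigr => i _; rewrite eq_sym.
rewrite mulSn mul1n; suff -> : (\sum_(i < n) (i %% k != n %% k) = n - n %/ k)%N by [].
have := count_modn n (ltn_pmod n k0).
have -> : ((n + k.-1 - n %% k) %/ k = n %/ k)%N.
  rewrite {1}(divn_eq n k) addnAC addnK divnMDl // [(k.-1 %/ k)%N]divn_small ?addn0 ?ltn_predL //.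
move=> <-; have tot : (\sum_(i < n) (i %% k != n %% k) + \sum_(i < n) (i %% k == n %% k) = n)%N.
  by rewrite -big_split /= (eq_bigr (fun=> 1%N)) ?sum1_card ?card_ord // => i _; case: eqP.
by rewrite -[X in (X - _)%N]tot addnK.
Qed.

Lemma turan_size0 k : turan_size k 0 = 0%N.
Proof. by apply/eqP; rewrite -(eqn_pmul2l (isT : 0 < 2)%N) turan_size_sum big_ord0. Qed.

Lemma turan_step (R : realFieldType) (k n : nat) : (0 < k)%N ->
  (1 - 1 / k%:R) * n%:R <= (n - n %/ k)%:R :> R /\
  (n - n %/ k)%:R <= (1 - 1 / k%:R) * n%:R + 1 :> R.
Proof.
move=> k0; have kR : 0 < k%:R :> R by rewrite ltr0n.
rewrite natrB ?leq_div //; have := divn_eq n k; have := ltn_pmod n k0.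
move: (n %/ k)%N (n %% k)%N => q s sk E.
have -> : (1 - 1 / k%:R) * n%:R = n%:R - n%:R / k%:R :> R by field; rewrite gt_eqF.
have -> : n%:R / k%:R = q%:R + s%:R / k%:R :> R.
  by rewrite E natrD natrM mulrDl mulfK ?gt_eqF.
have : s%:R / k%:R <= 1 :> R by rewrite ler_pdivrMr // mul1r ler_nat ltnW.
have : 0 <= s%:R / k%:R :> R by rewrite divr_ge0.
by move=> *; split; lra.
Qed.

Lemma turan_size_bounds (R : realFieldType) (k n : nat) : (0 < k)%N ->
  (1 - 1 / k%:R) * n%:R ^+ 2 - n%:R <= 2 * (turan_size k n)%:R :> R /\
  2 * (turan_size k n)%:R <= (1 - 1 / k%:R) * n%:R ^+ 2 + 2 * n%:R :> R.
Proof.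
move=> k0; have k1 : 1 <= k%:R :> R by rewrite ler1n.
have i0 : 0 <= 1 / k%:R :> R by rewrite divr_ge0.
have i1 : 1 / k%:R <= 1 :> R by rewrite ler_pdivrMr ?mul1r //; lra.
elim: n => [|n [IH1 IH2]].
  by rewrite turan_size0 expr0n /= !mulr0 addr0 subr0.
have [s1 s2] := turan_step R n k0; rewrite turan_sizeS // natrD -natr1.
move: (n - n %/ k)%N (1 / _ : R) i0 i1 IH1 IH2 s1 s2 => w i i0 i1 IH1 IH2 s1 s2.
have n0 := ler0n R n.
by rewrite sqrrD !expr1n !mulrDr !mulr1; split; lra.
Qed.

(** Turan's theorem. Vertices of degree at most [t - t %/ k] can be deleted without losing the
    surplus over the Turan number; once none is left, the minimum degree is large enough for
    [moon_moser] with $be=1/k$. *)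
Lemma turan_clique (T : finType) (G : {set {set T}}) (A : {set T}) (k : nat) :
  sgraph G -> (0 < k)%N -> (2 * turan_size k #|A| < arcs (adj G) A)%N ->
  exists Q, Q \in cliques (adj G) A k.+1.
Proof.
move=> sG k0; have [n] := ubnP #|A|; elim: n A => // n IH A An hA.
have A0 : (0 < #|A|)%N.
  rewrite lt0n; apply: contraTneq hA => A0.
  by rewrite A0 -leqNgt (leq_trans (arcs_le _ _)) // A0.
have [t tE] : exists t, #|A| = t.+1 by case: #|A| A0 => // t; exists t.
have [/exists_inP[u uA low] | ] :=
    boolP [exists u in A, #|nbrs G A u| <= t - t %/ k]%N.
  have cA : #|A :\ u| = t by move: tE; rewrite (cardsD1 u) uA => -[].
  have [||Q] := IH (A :\ u).
  - by rewrite cA -ltnS -tE.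
  - have := @arcs_setD T G A [set u]; rewrite sub1set big_set1 => /(_ uA).
    move: hA; rewrite tE cA turan_sizeS //.
    by move: low; set d := #|nbrs G A u|; set D := arcs _ (A :\ u); set D' := arcs _ A; move: (t - _)%N => w; lia.
  rewrite inE => /and3P[QA cQ clQ]; exists Q; rewrite inE cQ clQ !andbT.
  exact: subset_trans QA (subD1set _ _).
move=> /exists_inPn nolow.
have kR : 0 < k%:R :> rat by rewrite ltr0n.
have be0 : 0 < 1 / k%:R :> rat by rewrite divr_gt0.
have [|Nk hk] := @moon_moser T (adj G) (adj_irr sG) (@adj_sym T G) rat A k _ k0 be0 A0.
  rewrite /arcs natr_sum mulr_natr -sumr_const; apply: ler_sum => u uA.
  have := nolow u uA; rewrite -ltnNge -(ltr_nat rat) => lt.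
  have [s1 _] := turan_step rat t k0.
  have : #|A|%:R = t%:R + 1 :> rat by rewrite tE natr1.
  have : (t - t %/ k)%:R + 1 <= #|nbrs G A u|%:R :> rat.
    by rewrite natr1 ler_nat -(ltr_nat rat).
  move=> h1 ->; move: s1 h1; move: (1 / _ : rat) => i; rewrite /nbrs; lra.
by apply/card_gt0P; rewrite -(ltr0n rat) -(pmulr_rgt0 _ (ltr0Sn rat k));
  apply: lt_le_trans hk; rewrite mulr_gt0 ?ltr0n // mulr_gt0.
Qed.

End Turan.

Definition threshold_loss (R : realFieldType) (k : nat) : R :=
  2 * k%:R + loss R k + (k%:R + 1) * (2 + excess_min R k ^+ 2) + (k%:R + 1) ^+ 2.

Lemma chordal_from_core (R : realType) (T : finType) (G : {set {set T}}) (k : nat) (r : R)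
    (A : {set T}) (x : R) :
  sgraph G -> (0 < k)%N -> 1 <= r -> #|T|%:R <= r ^+ 2 ->
  excess_min R k * r <= x ->
  k%:R * x ^+ 2 <=
    (k%:R + 1) * ((arcs (adj G) A)%:R - (1 - 1 / k%:R) * #|A|%:R ^+ 2) ->
  exists H : {set {set T}}, [/\ H \subset G, chordal H &
    (k%:R - 1 / k%:R) * #|A|%:R + x - loss R k * r <= #|H|%:R].
Proof.
move=> sG k0 r1 hr xmin hx.
have c0 : 0 <= x.
  apply: le_trans xmin; have [_ h] := piece_cost_ge R k0; have := ler0n R k.
  by rewrite /excess_min /slack => hk; apply: mulr_ge0; lra.
have [||H [HG chH]] := chordal_descent sG k0 r1 hr (sub0set G) (chordal0 T) _ xmin
   (Z := set0) _ hx.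
- by move=> u v _ _; rewrite /adj inE.
- by rewrite cards0 divr_ge0.
by rewrite setI0 !cards0 !mulr0 addr0 !subr0; exists H.
Qed.

(** A single edge beyond the Turan number gives too little excess to start the descent. About $r$
    vertex deletions, each gaining $2s$ arcs over the Turan number with $s$ of order $r$, create
    enough; if some deletion is impossible, all degrees are large and one star suffices. *)
Lemma chordal_threshold (R : realType) (T : finType) (G : {set {set T}}) (k : nat) (r : R) :
  sgraph G -> (0 < k)%N -> 1 <= r -> #|T|%:R <= r ^+ 2 -> (turan_size k #|T| < #|G|)%N ->
  exists H : {set {set T}}, [/\ H \subset G, chordal H &
    (k%:R - 1 / k%:R) * #|T|%:R - threshold_loss R k * r <= #|H|%:R].
Proof.
move=> sG k0 r1 hr hG.
have K1 : 1 <= k%:R :> R by rewrite ler1n.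
have [_ gK] := piece_cost_ge R k0.
have c0_ge : 16 <= excess_min R k by rewrite /excess_min /slack; lra.
have L0 : 0 <= loss R k.
  apply: le_trans (loss_ge_star R k0); rewrite addr_ge0 ?sqr_ge0 // mulr_ge0 //; first lra.
  by rewrite /slack; lra.
pose S := excess_min R k ^+ 2.
have S0 : 256 <= S by rewrite /S expr2; nra.
have i0 : 0 <= 1 / k%:R :> R by rewrite divr_ge0.
have i1 : 1 / k%:R <= 1 :> R by rewrite ler_pdivrMr ?mul1r //; lra.
have Ki : k%:R * (1 / k%:R) = 1 :> R by rewrite mulrC divfK // gt_eqF //; lra.
have [|s [s_ge s_le]] := @nat_above R (S * r); first by rewrite mulr_ge0 //; lra.
have [|N [N_ge N_le]] := @nat_above R r; first by lra.
set goal := exists H, _.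
have core j : (j <= N)%N -> goal \/ exists A : {set T}, (#|A| + j)%N = #|T| /\
    (2 * turan_size k #|A| + 2 + 2 * j * s <= arcs (adj G) A)%N.
  elim: j => [|j IH] jN.
    right; exists setT; rewrite cardsT addn0; split=> //.
    have := handshake int sG; rewrite -natrM => /eqP; rewrite eqr_nat => /eqP <-.
    by move: hG; clear; lia.
  have [?|[A [cA hA]]] := IH (ltnW jN); first by left.
  have A0 : (0 < #|A|)%N.
    rewrite lt0n; apply: contraTneq hA => A0; rewrite -ltnNge.
    by apply: leq_ltn_trans (arcs_le _ _) _; rewrite A0; clear; lia.
  have [t tE] : exists t, #|A| = t.+1 by case: #|A| A0 => // t; exists t.
  have cAu u : u \in A -> #|A :\ u| = t by move=> uA; move: tE; rewrite (cardsD1 u) uA => -[].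
  have [/exists_inP[u uA hu] | /exists_inPn nohu] := boolP [exists u in A,
      2 * turan_size k t + 2 + 2 * j.+1 * s <= arcs (adj G) (A :\ u)]%N.
    right; exists (A :\ u); rewrite (cAu u uA); split=> //.
    by rewrite -cA tE addSnnS.
  (* No deletion gains enough, so every degree in [A] is at least [X], and any $(k+1)$-clique can
     serve as centre. *)
  left; have [Q hQ] : exists Q, Q \in cliques (adj G) A k.+1.
    by apply: turan_clique => //; apply: leq_trans hA; clear; lia.
  have hQ' : Q \in cliques (thin G set0) A k.+1.
    move: hQ; rewrite !inE => /and3P[-> -> /cliqueP clQ]; apply/cliqueP => u v uQ vQ uv.
    by rewrite /thin clQ // inE.
  pose X : R := (1 - 1 / k%:R) * #|A|%:R - 1 - s%:R.
  have degX v : v \in Q -> X <= #|nbrs G A v|%:R.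
    move=> vQ; have vA : v \in A.
      by move: hQ; rewrite inE => /and3P[/subsetP QA _ _]; apply: QA.
    have := @arcs_setD T G A [set v]; rewrite sub1set big_set1 => /(_ vA) h1.
    have := nohu v vA; rewrite -ltnNge => h2; rewrite tE turan_sizeS // in hA.
    have h3 : (t - t %/ k <= #|nbrs G A v| + s)%N.
      move: h1 h2 hA; set d := #|nbrs G A v|; set D := arcs _ (A :\ v); set D' := arcs _ A.
      move: (t - _)%N (turan_size _ _) => w tu.
      have -> : (2 * j.+1 * s = 2 * j * s + 2 * s)%N by clear; lia.
      by move: (2 * j * s)%N => p; clear; lia.
    have [s1 _] := turan_step R t k0.
    move: h3; rewrite -(ler_nat R) natrD /X tE -natr1 => h3.
    by move: i0 s1 h3; clear; move: (1 / _ : R) => i; lra.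
  have [|||H [HG chH leH]] := star_clique_real (H := set0) (X := X) _ _ _ hQ' degX.
  - exact: sub0set.
  - exact: chordal0.
  - by move=> u v _ _; rewrite /adj inE.
  exists H; split=> //; apply: le_trans leH.
  rewrite cards0 setI0 cards0 mulr0 subr0 add0r -cA natrD.
  have jN' : j%:R <= N%:R :> R by rewrite ler_nat ltnW.
  have jr : j%:R <= 2 * r by clear - jN' N_le r1; lra.
  have h1 : (k%:R - 1 / k%:R) * j%:R <= k%:R * (2 * r).
    have j0 := ler0n R j; have : (k%:R - 1 / k%:R) * j%:R <= k%:R * j%:R :> R by rewrite ler_wpM2r //; lra.
    have : k%:R * j%:R <= k%:R * (2 * r) by rewrite ler_wpM2l //; lra.
    by clear; lra.
  have h2 : (k%:R + 1) * (1 + s%:R) <= (k%:R + 1) * ((2 + S) * r).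
    by rewrite ler_wpM2l //; clear - K1 s_le r1; lra.
  have h3 : (k%:R + 1) ^+ 2 <= (k%:R + 1) ^+ 2 * r by rewrite ler_peMr ?sqr_ge0.
  have h4 : 0 <= loss R k * r by rewrite mulr_ge0 //; lra.
  have -> : (k%:R + 1) * X = (k%:R - 1 / k%:R) * #|A|%:R - (k%:R + 1) * (1 + s%:R)
      + (1 - k%:R * (1 / k%:R)) * #|A|%:R by rewrite /X; ring.
  by rewrite Ki /threshold_loss -/S; clear - h1 h2 h3 h4; lra.
have [// | [A [cA hA]]] := core N (leqnn N).
have [|| H [HG chH leH]] := @chordal_from_core R T G k r A (excess_min R k * r) sG k0 r1 hr => //.
  have [tb _] := turan_size_bounds R #|A| k0.
  move: hA; rewrite -(ler_nat R) !natrD !natrM => hA.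
  have At : #|A|%:R <= r ^+ 2 by apply: le_trans hr; rewrite ler_nat max_card.
  have Ns : r * (S * r) <= N%:R * s%:R by rewrite ler_pM // ?mulr_ge0 //; lra.
  have e1 : S * r ^+ 2 <= (arcs (adj G) A)%:R - (1 - 1 / k%:R) * #|A|%:R ^+ 2.
    have : 256 * r ^+ 2 <= S * r ^+ 2 by rewrite ler_wpM2r ?sqr_ge0.
    have r20 := sqr_ge0 r.
    have -> : S * r ^+ 2 = r * (S * r) by ring.
    by clear - tb hA At Ns r20; lra.
  rewrite exprMn -/S; apply: ler_pM; [lra | | lra | exact: e1].
  by rewrite mulr_ge0 ?sqr_ge0 //; lra.
exists H; split=> //; apply: le_trans leH; rewrite -cA natrD.
have h1 : (k%:R - 1 / k%:R) * N%:R <= k%:R * (2 * r).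
  have N0 := ler0n R N; have : (k%:R - 1 / k%:R) * N%:R <= k%:R * N%:R :> R by rewrite ler_wpM2r //; lra.
  have : k%:R * N%:R <= k%:R * (2 * r) by rewrite ler_wpM2l //; lra.
  by clear; lra.
have h2 : 0 <= (k%:R + 1) * (2 + S) * r by rewrite !mulr_ge0 //; lra.
have h3 : 0 <= (k%:R + 1) ^+ 2 * r by rewrite mulr_ge0 ?sqr_ge0 //; lra.
have h4 : 0 <= excess_min R k * r by rewrite mulr_ge0 //; lra.
by rewrite /threshold_loss -/S; clear - h1 h2 h3 h4; lra.
Qed.

Definition lower_loss (R : realFieldType) (k : nat) : R :=
  threshold_loss R k + loss R k + excess_min R k + 2.

Lemma lower_loss_ge0 (R : realFieldType) (k : nat) : (0 < k)%N -> 0 <= lower_loss R k.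
Proof.
move=> k0; have K1 : 1 <= k%:R :> R by rewrite ler1n.
have [_ gK] := piece_cost_ge R k0.
have L0 : 0 <= loss R k.
  apply: le_trans (loss_ge_star R k0); rewrite addr_ge0 ?sqr_ge0 // mulr_ge0 //; first lra.
  by rewrite /slack; lra.
have S0 : 0 <= (k%:R + 1) * (2 + excess_min R k ^+ 2).
  by rewrite mulr_ge0 ?addr_ge0 ?sqr_ge0 //; lra.
have e0 : 0 <= excess_min R k by rewrite /excess_min /slack; lra.
by have := sqr_ge0 (k%:R + 1 : R); rewrite /lower_loss /threshold_loss; lra.
Qed.

Lemma chordal_lower (R : realType) (T : finType) (G : {set {set T}}) (k : nat) (r x : R) :
  sgraph G -> (0 < k)%N -> 1 <= r -> #|T|%:R <= r ^+ 2 -> (turan_size k #|T| < #|G|)%N ->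
  k%:R * x ^+ 2 <= 2 * (k%:R + 1) * (#|G|%:R - (turan_size k #|T|)%:R) ->
  exists H : {set {set T}}, [/\ H \subset G, chordal H &
    (k%:R - 1 / k%:R) * #|T|%:R + x - lower_loss R k * r <= #|H|%:R].
Proof.
move=> sG k0 r1 hr hG hx.
have K1 : 1 <= k%:R :> R by rewrite ler1n.
have [_ gK] := piece_cost_ge R k0.
have c0_ge : 16 <= excess_min R k by rewrite /excess_min /slack; lra.
have L0 : 0 <= loss R k * r.
  rewrite mulr_ge0 //; last lra; apply: le_trans (loss_ge_star R k0).
  rewrite addr_ge0 ?sqr_ge0 // mulr_ge0 //; first lra.
  by rewrite /slack; lra.
have Tl0 : loss R k * r <= threshold_loss R k * r.
  rewrite ler_wpM2r //; first lra.
  have : 0 <= (k%:R + 1) * (2 + excess_min R k ^+ 2) by rewrite mulr_ge0 ?addr_ge0 ?sqr_ge0 //; lra.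
  by have := sqr_ge0 (k%:R + 1 : R); rewrite /threshold_loss; lra.
have [small | big] := lerP x ((excess_min R k + 2) * r).
  have [H [HG chH leH]] := chordal_threshold sG k0 r1 hr hG.
  exists H; split=> //; apply: le_trans leH.
  by rewrite /lower_loss; clear - small L0; lra.
(* Lowering the excess by $2r$ absorbs the error, linear in the number of vertices, of
   [turan_size_bounds]. *)
have [||H [HG chH leH]] := @chordal_from_core R T G k r setT (x - 2 * r) sG k0 r1 hr.
- by rewrite mulrDl in big; clear - big; lra.
- have hs := handshake R sG; rewrite -hs cardsT.
  have [tb _] := turan_size_bounds R #|T| k0.
  have h1 : (k%:R + 1) * (2 * (#|G|%:R - (turan_size k #|T|)%:R) - r ^+ 2) <=
      (k%:R + 1) * (2 * #|G|%:R - (1 - 1 / k%:R) * #|T|%:R ^+ 2) :> R.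
    by rewrite ler_wpM2l //; clear - K1 tb hr; lra.
  apply: le_trans h1.
  have h2 : 3 * r * r <= x * r.
    rewrite ler_wpM2r //; first lra.
    have cr : 16 * r <= excess_min R k * r by rewrite ler_wpM2r //; lra.
    by clear - big r1 cr; lra.
  have h3 : k%:R * (3 * r * r) <= k%:R * (x * r) by rewrite ler_wpM2l //; lra.
  have r0 : 0 <= r by clear - r1; lra.
  have h4 : r * r <= k%:R * (r * r) by rewrite ler_peMl // mulr_ge0.
  have h5 : 0 <= r * r by rewrite mulr_ge0.
  by clear - h3 h4 h5 hx; rewrite !expr2 in hx *; lra.
exists H; split=> //; apply: le_trans leH; rewrite cardsT /lower_loss.
have : 0 <= excess_min R k * r by rewrite mulr_ge0 //; lra.
by clear - Tl0 L0; lra.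
Qed.

(** * The extremal graph and the upper bound *)

Lemma clique_colours (T C : finType) (H : {set {set T}}) (c : T -> C) (S : {set T}) (F : {set C}) :
  (forall u v, adj H u v -> c u != c v) -> clique (adj H) S ->
  (forall u, u \in S -> c u \notin F) -> (#|S| + #|F| <= #|C|)%N.
Proof.
move=> prop /cliqueP clS SF; rewrite -(card_in_imset (f := c) (D := S)); last first.
  move=> u v uS vS cuv; apply/eqP; apply: contraT => uv.
  by have := prop u v (clS u v uS vS uv); rewrite cuv eqxx.
rewrite -(cardsC F) addnC leq_add2l; apply: subset_leq_card; apply/subsetP => _ /imsetP[u uS ->].
by rewrite inE SF.
Qed.

Section Construction.

Variables (y p q w : nat).
Local Notation U := ('I_y + 'I_y + 'I_w + 'I_p * 'I_q)%type.

(* The extremal graph: [p.+2] completely joined parts, two of size [y] and [p] of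
   size [q], and [w] more vertices that are joined to the last [p] parts only. *)
Definition near_turan : rel U := fun u v =>
  match u, v with
  | inl (inl (inl _)), inl (inl (inr _)) | inl (inl (inr _)), inl (inl (inl _)) => true
  | inl _, inl _ => false
  | inr a, inr b => a.1 != b.1
  | _, _ => true
  end.

Definition is_apart (u : U) : bool := if u is inl (inr _) then true else false.

(** The [w] vertices apart reuse colour 0, being joined to neither part of size [y]; their
    neighbours avoid colours 0 and 1. *)
Definition colour (u : U) : 'I_p.+2 :=
  match u with
  | inl (inl (inr _)) => inord 1
  | inl _ => ord0
  | inr a => inord a.1.+2
  end.

Lemma near_turan_sym : symmetric near_turan.
Proof. by case=> [[[a|a]|a]|a] [[[b|b]|b]|b] //=; rewrite eq_sym. Qed.

Lemma near_turan_irr : irreflexive near_turan.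
Proof. by case=> [[[a|a]|a]|a] //=; rewrite eqxx. Qed.

Lemma colour_gt1 (a : 'I_p * 'I_q) : val (colour (inr a)) = a.1.+2.
Proof. by rewrite /= inordK // !ltnS ltn_ord. Qed.

Lemma colour_proper u v : near_turan u v -> colour u != colour v.
Proof.
have c1 (a : 'I_y) : val (colour (inl (inl (inr a)))) = 1%N by rewrite /= inordK.
move: u v => [[[a|a]|a]|a] [[[b|b]|b]|b] // h; rewrite -val_eqE /= -/(val _) ?c1 ?colour_gt1 //.
Qed.

Lemma sum_near_turan :
  (\sum_(u : U) \sum_(v : U) near_turan u v =
     2 * (y * (y + p * q)) + w * (p * q) + p * q * (2 * y + w + p.-1 * q))%N.
Proof.
have sumU (F : U -> nat) : (\sum_u F u = \sum_(i < y) F (inl (inl (inl i))) +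
   \sum_(i < y) F (inl (inl (inr i))) + \sum_(i < w) F (inl (inr i)) +
   \sum_(j < p) \sum_(i < q) F (inr (j, i)))%N.
  by rewrite !big_sumType /= pair_bigA /=; congr (_ + _)%N; apply: eq_bigr => -[].
have const m c : (\sum_(i < m) c = m * c)%N by rewrite sum_nat_const card_ord.
have other (j : 'I_p) : (\sum_(j' < p) \sum_(i < q) (j != j') = p.-1 * q)%N.
  rewrite (eq_bigr (fun j' : 'I_p => (j != j') * q))%N => [|j' _]; last by rewrite const mulnC.
  rewrite -big_distrl /=; congr (_ * _)%N.
  rewrite (eq_bigr (fun j' : 'I_p => (j' != j) : nat)) => [|j' _]; last by rewrite eq_sym.
  by rewrite -big_mkcond /= sum1_card cardC1 card_ord.
rewrite sumU /=.
rewrite (eq_bigr (fun=> y + p * q)%N) => [|i _]; last first.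
  by rewrite sumU /= !const !muln0 !muln1 /=; lia.
rewrite [X in (_ + X + _ + _)%N](eq_bigr (fun=> y + p * q)%N) => [|i _]; last first.
  by rewrite sumU /= !const !muln0 !muln1 /=; lia.
rewrite [X in (_ + X + _)%N](eq_bigr (fun=> p * q)%N) => [|i _]; last first.
  by rewrite sumU /= !const !muln0 !muln1 /=; lia.
rewrite [X in (_ + X)%N](eq_bigr (fun=> q * (2 * y + w + p.-1 * q)))%N => [|j _]; last first.
  rewrite -const; apply: eq_bigr => i _.
  by rewrite sumU /= other !const !muln1; lia.
by rewrite !const; lia.
Qed.

End Construction.

Lemma near_turan_graph (n y p q w : nat) : (y + y + w + p * q = n)%N ->
  exists G : {set {set 'I_n}}, [/\ sgraph G,
    (2 * #|G| = 2 * (y * (y + p * q)) + w * (p * q) + p * q * (2 * y + w + p.-1 * q))%N &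
    forall H : {set {set 'I_n}}, H \subset G -> chordal H -> (#|H| + w <= p.+1 * n)%N].
Proof.
move=> nE; pose U := ('I_y + 'I_y + 'I_w + 'I_p * 'I_q)%type.
have [g [g' gK g'K]] : exists g : 'I_n -> U, bijective g.
  have cU : #|{: U}| = n by rewrite !card_sum card_prod !card_ord.
  by rewrite -cU; exists enum_val; apply: enum_val_bij.
pose e : rel 'I_n := fun u v => near_turan (g u) (g v).
have eI : irreflexive e by move=> u; apply: near_turan_irr.
have adjE u v : adj (edges e) u v = e u v by rewrite adj_edges /e near_turan_sym orbb.
have gsum (F : U -> nat) : (\sum_(i < n) F (g i) = \sum_u F u)%N.
  by rewrite [RHS](reindex g) //; exists g' => u _.
exists (edges e); split; first exact: sgraph_edges.
  apply/eqP; rewrite -(eqr_nat int) natrM handshake ?sgraph_edges // eqr_nat.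
  rewrite -sum_near_turan -gsum /arcs; apply/eqP; rewrite big_mkcond.
  apply: eq_bigr => u _; rewrite inE -gsum -sum1_card big_mkcond; apply: eq_bigr => v _.
  by rewrite !inE adjE /e; case: near_turan.
move=> H HG chH.
have adjH u v : adj H u v -> near_turan (g u) (g v) by move=> /(adj_sub HG); rewrite adjE.
have proper u v : adj H u v -> colour (g u) != colour (g v).
  by move=> /adjH; apply: colour_proper.
(* A clique of neighbours of [v] has distinct colours and misses that of [v], or both 0 and 1 if [v]
   is apart. *)
pose cap (v : 'I_n) := (p.+1 - is_apart (g v))%N.
have sH : sgraph H.
  by apply/forall_inP => E /(subsetP HG); move: E; apply/forall_inP; apply: sgraph_edges.
have capS v (S : {set 'I_n}) : clique (adj H) S -> (forall u, u \in S -> adj H v u) ->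
    (#|S| <= cap v)%N.
  move=> clS vS; rewrite /cap; case vA: (is_apart (g v)); last first.
    have := @clique_colours _ _ H (fun u => colour (g u)) S [set colour (g v)] proper clS.
    rewrite cards1 card_ord addn1 subn0 ltnS; apply=> u uS.
    by rewrite inE eq_sym; apply: proper; apply: vS.
  have := @clique_colours _ _ H (fun u => colour (g u)) S [set i | val i <= 1]%N proper clS.
  rewrite card_ord (_ : #|[set i : 'I_p.+2 | val i <= 1]%N| = 2%N).
    rewrite addn2 !ltnS subn1 => h; apply: h => u /vS /adjH.
    by rewrite inE /=; case: (g v) vA => [[]|] // a _; case: (g u) => [[[]|]|b] //; rewrite colour_gt1.
  rewrite (_ : [set _ | _] = [set ord0; inord 1]); first by rewrite cards2 -val_eqE /= inordK.
  apply/setP => i; rewrite !inE -!val_eqE /= inordK //.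
  by case: (val i) => [|[|]].
have := chordal_card_le sH chH capS.
have -> : (p.+1 * n = \sum_(v < n) cap v + w)%N; last by rewrite leq_add2r.
have <- : (\sum_(v < n) is_apart (g v) = w)%N.
  rewrite (gsum (fun u => is_apart u : nat)) !big_sumType /=.
  by rewrite !big1_eq // sum_nat_const card_ord muln1 addn0.
rewrite -big_split /= (eq_bigr (fun=> p.+1)) ?sum_nat_const ?card_ord 1?mulnC // => v _.
by rewrite /cap subnK //; case: is_apart.
Qed.

Lemma turan_graph_chordal (k n : nat) (H : {set {set 'I_n}}) : H \subset turan_graph k.+1 n -> chordal H ->
  (#|H| <= k * n)%N.
Proof.
move=> HG chH.
have sH : sgraph H.
  by apply/forall_inP => E /(subsetP HG); move: E; apply/forall_inP; apply: sgraph_turan.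
pose c (u : 'I_n) : 'I_k.+1 := inord (u %% k.+1).
have proper u v : adj H u v -> c u != c v.
  move=> /(adj_sub HG); rewrite turan_graphE adj_edges eq_sym orbb.
  by rewrite -val_eqE /= !inordK ?ltn_pmod // eq_sym.
have := @chordal_card_le _ H (fun=> k) sH chH; rewrite sum_nat_const card_ord mulnC.
apply=> v S clS vS.
have := @clique_colours _ _ H c S [set c v] proper clS.
rewrite cards1 card_ord addn1 ltnS; apply=> u uS.
by rewrite inE eq_sym; apply: proper; apply: vS.
Qed.

Lemma sgraph_card_le (T : finType) (G : {set {set T}}) : sgraph G -> (#|G| <= 'C(#|T|, 2))%N.
Proof.
move=> /forall_inP sG; rewrite -card_draws; apply: subset_leq_card.
by apply/subsetP => E /sG; rewrite inE.
Qed.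

(** Any subgraph of [G] with exactly [m] edges inherits the bound, so an extremal graph may have
    edges to spare. *)
Lemma f_le (n m b : nat) (G : {set {set 'I_n}}) : sgraph G -> (m <= #|G|)%N ->
  (forall H : {set {set 'I_n}}, H \subset G -> chordal H -> (#|H| <= b)%N) -> (f n m <= b)%N.
Proof.
move=> sG mG hb; have mn : (m <= 'C(n, 2))%N.
  by apply: leq_trans mG _; have := sgraph_card_le sG; rewrite card_ord.
have := leqnn (f n m); rewrite {1}leq_f // => /forallP gu.
have [G' G'G cG'] := exists_subset_card mG.
have /existsP[H /and3P[HG' chH]] : [exists H : {set {set 'I_n}},
    [&& H \subset G', chordal H & f n m <= #|H|]%N].
  apply: (implyP (gu G')); rewrite cG' eqxx andbT; apply/forall_inP => E /(subsetP G'G).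
  by move: E; apply/forall_inP.
by move=> /leq_trans; apply; apply: hb => //; apply: subset_trans G'G.
Qed.

Lemma f_ge (R : realType) (n m : nat) (b : R) : (m <= 'C(n, 2))%N ->
  (forall G : {set {set 'I_n}}, sgraph G -> #|G| = m ->
     exists H : {set {set 'I_n}}, [/\ H \subset G, chordal H & b <= #|H|%:R]) ->
  b <= (f n m)%:R.
Proof.
move=> mn hG; rewrite leNgt; apply/negP => lt.
have : ((f n m).+1 <= f n m)%N; last by rewrite ltnn.
rewrite leq_f //; apply/forallP => G; apply/implyP => /andP[sG /eqP cG].
have [H [HG chH bH]] := hG G sG cG.
apply/existsP; exists H; rewrite HG chH /= -(ltr_nat R); exact: lt_le_trans bH.
Qed.

(* For [y], [q] and [w] about [K z], [N / K - z] and [N / K - (K + 1) z]. *)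
Lemma near_turan_size (R : realFieldType) (K i N z y q w : R) :
  1 <= K -> K * i = 1 -> 0 <= z -> 0 <= y -> K * z - 1 <= y ->
  N * i - z - 1 <= q -> q <= N * i - z -> w = N - 2 * y - (K - 1) * q ->
  (1 - i) * N ^+ 2 + K * (K + 1) * z ^+ 2 - 2 * (K * (K + 1) * z) - K ^+ 2 <=
    2 * (y * (y + (K - 1) * q)) + w * ((K - 1) * q) +
    ((K - 1) * q * (2 * y + w) + ((K - 1) ^+ 2 - (K - 1)) * q ^+ 2).
Proof.
move=> K1 Ki z0 y0 yz qz zq ->.
(* In terms of [d] the right-hand side is $(1-i)N^2+2y^2-K(K-1)d^2$, with $y\approx Kz$ and
   $d\approx z$. *)
have [d dE] : exists d, d = N * i - q by exists (N * i - q).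
have qE : q = N * i - d by rewrite dE; ring.
have dz : 0 <= d by lra.
have d2 : d ^+ 2 <= (z + 1) ^+ 2 by rewrite ler_sqr ?nnegrE; lra.
have y2 : K ^+ 2 * z ^+ 2 - 2 * K * z <= y ^+ 2.
  have Kz : 0 <= K * z by rewrite mulr_ge0 //; lra.
  have [h | h] := lerP (K * z) 1.
    have : 0 <= y ^+ 2 by apply: sqr_ge0.
    have : K * z * (K * z) <= K * z * 1 by rewrite ler_wpM2l.
    have -> : K ^+ 2 * z ^+ 2 = K * z * (K * z) by ring.
    by lra.
  have : (K * z - 1) ^+ 2 <= y ^+ 2 by rewrite ler_sqr ?nnegrE; lra.
  have -> : (K * z - 1) ^+ 2 = K ^+ 2 * z ^+ 2 - 2 * K * z + 1 by ring.
  by lra.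
have -> : 2 * (y * (y + (K - 1) * q)) + (N - 2 * y - (K - 1) * q) * ((K - 1) * q) +
    ((K - 1) * q * (2 * y + (N - 2 * y - (K - 1) * q)) + ((K - 1) ^+ 2 - (K - 1)) * q ^+ 2) =
    2 * y ^+ 2 + (K - 1) * (2 * (K * i) * (N * q) - K * q ^+ 2) + 2 * (1 - K * i) * (K - 1) * N * q.
  by ring.
have -> : (K - 1) * (2 * (K * i) * (N * q) - K * q ^+ 2) =
    (K * i) * (K * i - i) * N ^+ 2 - K * (K - 1) * d ^+ 2 by rewrite qE; ring.
rewrite Ki.
have : K * (K - 1) * d ^+ 2 <= K * (K - 1) * (z + 1) ^+ 2.
  by rewrite ler_wpM2l // mulr_ge0 //; lra.
clear - y2 K1; rewrite !expr2 in y2 *; lra.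
Qed.

Lemma f_upper (R : realType) (k n m : nat) (r x : R) :
  (0 < k)%N -> 1 <= r -> n%:R = r ^+ 2 -> 0 <= x ->
  (turan_size k n <= m)%N -> (m <= turan_size k.+1 n)%N ->
  k%:R * x ^+ 2 = 2 * (k%:R + 1) * (m%:R - (turan_size k n)%:R) ->
  (f n m)%:R <= (k%:R - 1 / k%:R) * n%:R + x + (2 * k%:R + 4) * r.
Proof.
move=> k0 r1 nE x0 mlo mhi hx.
have K1 : 1 <= k%:R :> R by rewrite ler1n.
have [i iE] : exists i, i = 1 / k%:R :> R by exists (1 / k%:R).
have Ki : k%:R * i = 1 by rewrite iE mulrC divfK // gt_eqF //; lra.
rewrite -iE.
have r0 : 0 <= r by lra.
have N0 : 0 <= n%:R :> R by rewrite ler0n.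
have Dr0 : 0 <= (2 * k%:R + 4) * r by rewrite mulr_ge0 //; lra.
(* In the first case the bound exceeds $kn$, and the Turan graph with $k+1$ parts suffices. *)
have [big | small] := lerP (n%:R * i) (x + (2 * k%:R + 4) * r).
  have : (f n m)%:R <= k%:R * n%:R :> R.
    rewrite -natrM ler_nat; apply: f_le (sgraph_turan k.+1 n) mhi _.
    exact: turan_graph_chordal.
  by clear - big; lra.
(* The padding of [x] makes up for rounding the part sizes and for the error in [turan_size_bounds];
   $z=x'/(k+1)$ gives at least $n/k-x'$ vertices apart. *)
have [x' xE] : exists x', x' = x + (2 * k%:R + 4) * r by exists (x + (2 * k%:R + 4) * r).
rewrite -addrA -xE; rewrite -xE in small.
have x'0 : 0 <= x' by rewrite xE addr_ge0.
have [z zE] : exists z, x' = (k%:R + 1) * z.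
  by exists (x' / (k%:R + 1)); rewrite mulrC divfK // gt_eqF //; lra.
have z0 : 0 <= z by move: x'0; rewrite zE pmulr_rge0 //; lra.
have Kz0 : 0 <= k%:R * z by rewrite mulr_ge0 //; lra.
pose y := Num.trunc (k%:R * z); pose q := Num.trunc (n%:R * i - z).
have yle : y%:R <= k%:R * z by rewrite truncn_le.
have ygt : k%:R * z < y%:R + 1 by rewrite natr1 truncnS_gt.
have nz0 : 0 <= n%:R * i - z.
  have : z <= x' by rewrite zE ler_peMl //; lra.
  by clear - small; lra.
have qle : q%:R <= n%:R * i - z by rewrite truncn_le.
have qgt : n%:R * i - z < q%:R + 1 by rewrite natr1 truncnS_gt.
have pE : (k.-1)%:R = k%:R - 1 :> R by rewrite -[in RHS](prednK k0) -natr1 addrK.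
have ypq : 2 * y%:R + (k%:R - 1) * q%:R <= n%:R - (n%:R * i - x') :> R.
  have h : (k%:R - 1) * q%:R <= (k%:R - 1) * (n%:R * i - z) by rewrite ler_wpM2l //; lra.
  have e : (k%:R - 1) * (n%:R * i - z) = (k%:R * i) * n%:R - n%:R * i - k%:R * z + z by ring.
  rewrite e Ki in h; rewrite zE; clear - h yle; lra.
have le_n : (y + y + k.-1 * q <= n)%N.
  by rewrite -(ler_nat R) !natrD natrM pE; clear - ypq small; lra.
pose w := (n - (y + y + k.-1 * q))%N.
have nS : (y + y + w + k.-1 * q = n)%N by rewrite -addnA (addnC w) addnA subnKC.
have wE : w%:R = n%:R - 2 * y%:R - (k%:R - 1) * q%:R :> R.
  by rewrite /w natrB // !natrD natrM pE; ring.
have [G [sG cG chG]] := near_turan_graph nS.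
have mG : (m <= #|G|)%N.
  have cGR : 2 * #|G|%:R = 2 * (y%:R * (y%:R + (k%:R - 1) * q%:R)) + w%:R * ((k%:R - 1) * q%:R) +
      ((k%:R - 1) * q%:R * (2 * y%:R + w%:R) + ((k%:R - 1) ^+ 2 - (k%:R - 1)) * q%:R ^+ 2) :> R.
    have ppE : k.-1%:R * k.-1.-1%:R = (k%:R - 1) ^+ 2 - (k%:R - 1) :> R.
      rewrite -pE; case: (k.-1) => [|j] /=; first by rewrite mul0r expr0n subr0.
      by rewrite -natr1; ring.
    rewrite -ppE -pE -natrM cG !(natrD, natrM); ring.
  rewrite -(ler_nat R); have K20 : 0 < 2 * (k%:R + 1) :> R by lra.
  rewrite -(ler_pM2l K20).
  have -> : 2 * (k%:R + 1) * #|G|%:R = (k%:R + 1) * (2 * #|G|%:R) :> R by ring.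
  rewrite cGR.
  have yz : k%:R * z - 1 <= y%:R by lra.
  have qz : n%:R * i - z - 1 <= q%:R by lra.
  have nt := near_turan_size K1 Ki z0 (ler0n R y) yz qz qle wE.
  have [_ tb] := turan_size_bounds R n k0; rewrite -iE in tb.
  have nt' : (k%:R + 1) * ((1 - i) * n%:R ^+ 2 + k%:R * (k%:R + 1) * z ^+ 2 -
      2 * (k%:R * (k%:R + 1) * z) - k%:R ^+ 2) <= (k%:R + 1) *
    (2 * (y%:R * (y%:R + (k%:R - 1) * q%:R)) + w%:R * ((k%:R - 1) * q%:R) +
    ((k%:R - 1) * q%:R * (2 * y%:R + w%:R) + ((k%:R - 1) ^+ 2 - (k%:R - 1)) * q%:R ^+ 2)).
    by rewrite ler_wpM2l //; lra.
  apply: le_trans nt'; have tb' : (k%:R + 1) * (2 * (turan_size k n)%:R) <=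
      (k%:R + 1) * ((1 - i) * n%:R ^+ 2 + 2 * n%:R) :> R by rewrite ler_wpM2l //; lra.
  have -> : (k%:R + 1) * ((1 - i) * n%:R ^+ 2 + k%:R * (k%:R + 1) * z ^+ 2 -
      2 * (k%:R * (k%:R + 1) * z) - k%:R ^+ 2) = (k%:R + 1) * ((1 - i) * n%:R ^+ 2)
      + k%:R * x' ^+ 2 - (k%:R + 1) * (2 * (k%:R * x') + k%:R ^+ 2) by rewrite zE; ring.
  have Kx' : k%:R * x' <= n%:R.
    have h : k%:R * x' <= k%:R * (n%:R * i) by rewrite ler_wpM2l ?ler0n // ltW.
    by apply: le_trans h _; rewrite mulrCA Ki mulr1.
  have n1 : 1 <= n%:R :> R by rewrite nE expr_ge1.
  have kn : k%:R ^+ 2 <= k%:R ^+ 2 * n%:R :> R by rewrite ler_peMr ?sqr_ge0.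
  have h1 : (k%:R + 1) * (2 * n%:R + (2 * (k%:R * x') + k%:R ^+ 2)) <=
      2 * k%:R * (4 * n%:R + k%:R ^+ 2 * n%:R).
    apply: ler_pM; [lra | | lra | clear - Kx' kn; lra].
    by rewrite !addr_ge0 ?mulr_ge0 ?sqr_ge0 ?ler0n.
  (* The square of the padding is a multiple of $n$ that outweighs the error terms in [h1]. *)
  have h2 : k%:R * (x ^+ 2 + (2 * k%:R + 4) ^+ 2 * n%:R) <= k%:R * x' ^+ 2.
    rewrite ler_wpM2l ?ler0n // xE nE -exprMn sqrrD -addrA lerD2l lerDr mulrn_wge0 //.
    exact: mulr_ge0.
  have h3 : 0 <= k%:R * (k%:R * n%:R) :> R by rewrite !mulr_ge0.
  have h4 : 0 <= k%:R * (k%:R ^+ 2 * n%:R) :> R by rewrite !mulr_ge0 ?sqr_ge0.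
  have h5 : 0 <= k%:R * n%:R :> R by rewrite mulr_ge0.
  clear - h1 h2 h3 h4 h5 tb' hx; rewrite !expr2 in h1 h2 h4 hx *; lra.
have : (f n m <= k * n - w)%N.
  apply: f_le sG mG _ => H HG chH; have := chG H HG chH.
  by rewrite prednK // => h; rewrite leq_subRL ?(leq_trans (leq_addl _ _) h) // addnC.
have wkn : (w <= k * n)%N.
  by apply: leq_trans (leq_subr _ _) _; rewrite leq_pmull.
rewrite -(ler_nat R) natrB // natrM wE => h; clear - h ypq; lra.
Qed.

Theorem theorem1p3 (R : realType) (k : nat) (hk : (1 <= k)%N) :
  exists C : R, forall n m : nat,
    (1 <= n)%N -> (turan_size k n + 1 <= m <= turan_size k.+1 n)%N ->
    let a : R := m%:R - (turan_size k n)%:R in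
    `| (f n m)%:R
       - ((k%:R - 1 / k%:R) * n%:R
          + Num.sqrt (2 * (k%:R + 1) * a / k%:R)
          - 'C(k.+1, 2)%:R) |
    <= C * Num.sqrt n%:R.
Proof.
have K1 : 1 <= k%:R :> R by rewrite ler1n.
(* The two error constants are added; the binomial coefficient depends only on [k] and is absorbed
   because $\sqrt n\ge 1$. *)
exists (lower_loss R k + (2 * k%:R + 4) + 'C(k.+1, 2)%:R) => n m n1 /andP[mlo mhi].
cbv zeta; set a : R := m%:R - _.
set r : R := Num.sqrt n%:R; set x : R := Num.sqrt _.
have rE : n%:R = r ^+ 2 by rewrite sqr_sqrtr ?ler0n.
have r1 : 1 <= r by rewrite -sqrtr1 ler_sqrt ?ltr0n // ler1n.
rewrite addn1 in mlo.
have a0 : 0 <= a by rewrite subr_ge0 ler_nat ltnW.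
have x0 : 0 <= x by apply: sqrtr_ge0.
have xE : k%:R * x ^+ 2 = 2 * (k%:R + 1) * a.
  rewrite sqr_sqrtr; first by field; rewrite gt_eqF //; lra.
  by rewrite divr_ge0 ?mulr_ge0 //; lra.
have up := f_upper hk r1 rE x0 (ltnW mlo) mhi xE.
have lo : (k%:R - 1 / k%:R) * n%:R + x - lower_loss R k * r <= (f n m)%:R.
  apply: f_ge => [|G sG cG].
    by apply: leq_trans mhi _; have := sgraph_card_le (sgraph_turan k.+1 n); rewrite card_ord.
  have := @chordal_lower R _ G k r x sG hk r1; rewrite card_ord rE cG; apply=> //.
  by rewrite xE.
have L0 : 0 <= lower_loss R k * r.
  rewrite mulr_ge0 //; last lra.
  exact: lower_loss_ge0.
have B0 : 0 <= 'C(k.+1, 2)%:R :> R by rewrite ler0n.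
have Br : 'C(k.+1, 2)%:R <= 'C(k.+1, 2)%:R * r by rewrite ler_peMr.
have Dr0 : 0 <= (2 * k%:R + 4) * r by rewrite mulr_ge0 //; lra.
rewrite ler_norml; clear - up lo L0 B0 Br Dr0.
by apply/andP; split; lra.
Qed.
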